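(* Let $\mathcal A$ be a preabelian DG-category. Then $H^0(\mathcal A)$ naturally admits a pretriangulated structure $(\Omega,\Sigma,\Delta,\nabla)$, where $\Omega$ is the loop functor, $\Sigma$ is the suspension functor, $\Delta$ is the class of all triangles isomorphic to standard left triangles, and $\nabla$ is the class of all triangles isomorphic to standard right triangles.
   Context: **DG-categories.** Let $k$ be a commutative ring. DG-categories are $k$-linear with cohomological grading (differential $d$ of degree $+1$). All DG-categories $\mathcal A$ are assumed non-positive: $\mathcal A(X,Y)^i=0$ for $i>0$. A morphism $f$ is closed if $d(f)=0$. $H^0(\mathcal A)$ is the homotopy category. **Exactness.** For a chain map $\varphi:M\to N$ let $\mathrm{Fib}(\varphi)=\mathrm{Cone}(\varphi)[-1]$ be the complex $\mathrm{Fib}(\varphi)^i=M^i\oplus N^{i-1}$, $d(m,h)=(dm,-\varphi(m)-dh)$. A 3-term homotopy complex $(f,g,h)$ consists of closed degree-$0$ morphisms $f:X\to Y$, $g:Y\to Z$ and a degree $-1$ morphism $h:X\to Z$ with $d(h)=-g\circ f$. It is left exact (a homotopy kernel of $g$) if for every object $W$ and every $i\le 0$ the chain map $\mathcal A(W,X)\to \mathrm{Fib}(g\circ-:\mathcal A(W,Y)\to\mathcal A(W,Z))$, $u\mapsto (f\circ u,h\circ u)$, induces an isomorphism on $H^i$. It is right exact (a homotopy cokernel of $f$) if for every $W$ and $i\le0$ the chain map $\mathcal A(Z,W)\to\mathrm{Fib}(-\circ f:\mathcal A(Y,W)\to\mathcal A(X,W))$, $u\mapsto(u\circ g,(-1)^{|u|}u\circ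 h)$, induces an isomorphism on $H^i$. $\mathcal A$ is preabelian if $H^0(\mathcal A)$ is additive and every closed degree-$0$ morphism has a homotopy kernel and a homotopy cokernel. **Loops and suspensions.** A loop object of $X$ is a pair $(\Omega X,h_X)$ with $h_X:\Omega X\to X$ closed of degree $-1$ such that $h_X\circ-:H^i(\mathcal A(W,\Omega X))\to H^{i-1}(\mathcal A(W,X))$ is an isomorphism for all $W$ and $i\le 0$. A suspension object is a pair $(\Sigma X,h^X)$ with $h^X:X\to\Sigma X$ closed of degree $-1$ such that $-\circ h^X:H^i(\mathcal A(\Sigma X,W))\to H^{i-1}(\mathcal A(X,W))$ is an isomorphism for all $W$ and $i\le0$. In a preabelian DG-category they exist for all objects. The functors $\Omega,\Sigma:H^0(\mathcal A)\to H^0(\mathcal A)$ are given on $f:X\to Y$ as follows: $\Omega f$ is the unique class $f'$ for which there is a degree $-2$ morphism $t$ with $d(t)=h_Y\circ f'-f\circ h_X$; $\Sigma f$ is the unique class $f'$ for which there is $t$ of degree $-2$ with $d(t)=f'\circ h^X-h^Y\circ f$. The adjunction $\Sigma\dashv\Omega$ is the bijection under which $f:\Sigma X\to Y$ corresponds to $f':X\to\Omega Y$ iff there is a degree $-2$ morphism $t:X\to Y$ with $d(t)=f\circ h^X+h_Y\circ f'$. **Standard triangles.** A standard left triangle for $f_0:A_1\to A_0$ is the diagram $\Omega A_0\xrightarrow{f_2}A_2\xrightarrow{f_1}A_1\xrightarrow{f_0}A_0$ in $H^0(\mathcal A)$, where $(f_1,f_0,h_{f_0})$ is left exact and $f_2$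 is closed of degree $0$ such that there exist $h_{f_1}:\Omega A_0\to A_1$ of degree $-1$ with $d(h_{f_1})=-f_1\circ f_2$ and $\eta:\Omega A_0\to A_0$ of degree $-2$ with $d(\eta)=f_0\circ h_{f_1}-h_{f_0}\circ f_2-h_{A_0}$ (then $(f_2,f_1,h_{f_1})$ is also left exact). Dually, a standard right triangle for $f_0:A_0\to A_1$ is $A_0\xrightarrow{f_0}A_1\xrightarrow{f_1}A_2\xrightarrow{f_2}\Sigma A_0$, where $(f_0,f_1,h^{f_0})$ is right exact and $f_2$ is closed of degree $0$ such that there exist $h^{f_1}:A_1\to\Sigma A_0$ of degree $-1$ with $d(h^{f_1})=-f_2\circ f_1$ and $\eta$ of degree $-2$ with $d(\eta)=h^{A_0}+f_2\circ h^{f_0}-h^{f_1}\circ f_0$. **Left triangulated categories.** Let $\mathcal C$ be additive, $\Omega:\mathcal C\to\mathcal C$ an additive functor, and $\Delta$ a class of diagrams (''triangles'') $\Omega A\to C\to B\to A$ closed under isomorphism (a morphism of triangles is a triple $(\gamma,\beta,\alpha)$ which together with $\Omega\alpha$ makes all squares commute). $(\mathcal C,\Omega,\Delta)$ is left triangulated if: (LT1) $0\to A= A\to0$ is in $\Delta$ for every $A$, and every $f:B\to A$ fits into some $\Omega A\to C\to B\xrightarrow{f}A$ in $\Delta$. (LT2) If $\Omega A\xrightarrow{h}C\xrightarrow{g}B\xrightarrow{f}A$ is in $\Delta$, so is $\Omega B\xrightarrow{-\Omega f}\Omega A\xrightarrow{h}C\xrightarrow{g}B$. (LT3) Given two triangles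 in $\Delta$ and $(\beta,\alpha)$ making the rightmost square commute, there is $\gamma$ such that $(\gamma,\beta,\alpha)$ is a morphism of triangles. (LT4) Given $\Omega A\xrightarrow{f''}F\xrightarrow{f'}B\xrightarrow{f}A$ and $\Omega B\xrightarrow{g''}E\xrightarrow{g'}C\xrightarrow{g}B$ in $\Delta$, there are triangles $\Omega A\xrightarrow{v''}D\xrightarrow{v'}C\xrightarrow{f\circ g}A$ and $\Omega F\xrightarrow{u''}E\xrightarrow{u'}D\xrightarrow{u}F$ in $\Delta$ with $v'u'=g'$, $f'u=gv'$, $uv''=f''$, $u''=g''\circ\Omega f'$, $u'g''=v''\circ\Omega f$. Right triangulated categories $(\mathcal C,\Sigma,\nabla)$ are defined dually, with triangles $A\to B\to C\to\Sigma A$. **Pretriangulated categories (Beligiannis–Reiten).** $(\mathcal C,\Sigma,\Omega,\Delta,\nabla)$ is pretriangulated if: (i) $\Sigma\dashv\Omega$; (ii) $(\mathcal C,\Omega,\Delta)$ is left triangulated and $(\mathcal C,\Sigma,\nabla)$ is right triangulated; (iii) for every $A\to B\to C\to\Sigma A$ in $\nabla$, every $\Omega C'\to A'\to B'\to C'$ in $\Delta$, and every $a:A\to\Omega C'$, $b:B\to A'$ making the left square commute, there is $C\to B'$ making the whole ladder with vertical maps $a$, $b$, $C\to B'$, $\overline a:\Sigma A\to C'$ commute, where $\overline a$ is adjoint to $a$; (iv) the dual: given $\beta:C\to B'$ and $\gamma:\Sigma A\to C'$ making the right square commute, there is $B\to A'$ making the ladder with vertical maps $\overline\gamma:A\to\Omega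 C'$, $B\to A'$, $\beta$, $\gamma$ commute, where $\overline\gamma$ is adjoint to $\gamma$. *)

(* Defs.v *)
From HB Require Import structures.
From mathcomp Require Import all_boot all_order all_algebra.
From mathcomp Require Import boolp.

Set Implicit Arguments.
Unset Strict Implicit.
Unset Printing Implicit Defensive.

Import Order.TTheory GRing.Theory Num.Theory.
Local Open Scope ring_scope.
Local Open Scope quotient_scope.

Section Linear.
Variables (k : comPzRingType) (U V : lmodType k) (f : U -> V).
Hypothesis lin : linear f.

HB.instance Definition _ := GRing.isLinear.Build k U V *:%R f lin.

Lemma linear_0 : f 0 = 0. Proof. exact: (raddf0 f). Qed.
Lemma linear_D u v : f (u + v) = f u + f v. Proof. exact: (raddfD f). Qed.
Lemma linear_B u v : f (u - v) = f u - f v. Proof. exact: (raddfB f). Qed.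
Lemma linear_sum I (s : seq I) F : f (\sum_(i <- s) F i) = \sum_(i <- s) f (F i).
Proof. exact: (raddf_sum f). Qed.

End Linear.

(** * DG-modules and cohomology *)

(* A cochain complex of k-modules, presented as the internally graded module  *)
(* M = (+)_i M^i: [gpart i] is the projection onto M^i followed by the        *)
(* inclusion into M, so that M^i = {u | gpart i u = u}.                       *)
Record dgModule (k : comPzRingType) := DgModule {
  dg_sort :> lmodType k;
  gpart : int -> dg_sort -> dg_sort;
  dif : dg_sort -> dg_sort;
  gpart_linear : forall i, linear (gpart i);
  gpart_gpart : forall i j u,
    gpart i (gpart j u) = if i == j then gpart j u else 0;
  gpart_sum : forall u, exists2 s : seq int, uniq s & u = \sum_(i <- s) gpart i u;
  dif_linear : linear dif;
  dif_degree : forall i u, gpart i u = u -> gpart (i + 1) (dif u) = dif u;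
  dif_dif : forall u, dif (dif u) = 0
}.

Section Cohomology.
Context {k : comPzRingType}.

Definition homog (M : dgModule k) (i : int) (u : M) : Prop := gpart i u = u.

Section Degree.
Variables (M : dgModule k) (i : int).

HB.instance Definition _ (j : int) :=
  GRing.isLinear.Build k M M *:%R (@gpart k M j) (@gpart_linear k M j).
HB.instance Definition _ :=
  GRing.isLinear.Build k M M *:%R (@dif k M) (@dif_linear k M).

Lemma homog0 j : @homog M j 0. Proof. exact: raddf0. Qed.
Lemma homogB j (u v : M) : homog j u -> homog j v -> homog j (u - v).
Proof. by rewrite /homog raddfB /= => -> ->. Qed.

Definition is_cocycle : {pred M} := fun u => `[< homog i u /\ dif u = 0 >].

Lemma is_cocycleP (u : M) : reflect (homog i u /\ dif u = 0) (u \in is_cocycle).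
Proof. exact: asboolP. Qed.

Fact is_cocycle_zmod_closed : zmod_closed is_cocycle.
Proof.
split; first by apply/is_cocycleP; split; [exact: homog0 | exact: raddf0].
move=> u v /is_cocycleP[hu du] /is_cocycleP[hv dv]; apply/is_cocycleP.
by split; [exact: homogB | rewrite raddfB /= du dv subrr].
Qed.
HB.instance Definition _ :=
  GRing.isZmodClosed.Build M is_cocycle is_cocycle_zmod_closed.

Record cocycle := Cocycle { cval :> M; cvalP : cval \in is_cocycle }.
HB.instance Definition _ := [isSub for cval].
HB.instance Definition _ := [Choice of cocycle by <:].
HB.instance Definition _ := [SubChoice_isSubZmodule of cocycle by <:].

Definition is_coboundary : {pred cocycle} :=
  fun u => `[< exists2 w : M, homog (i - 1) w & dif w = u >].

Lemma is_coboundaryP (u : cocycle) :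
  reflect (exists2 w : M, homog (i - 1) w & dif w = u) (u \in is_coboundary).
Proof. exact: asboolP. Qed.

Fact is_coboundary_zmod_closed : zmod_closed is_coboundary.
Proof.
split; first by apply/is_coboundaryP; exists 0; [exact: homog0 | exact: raddf0].
move=> u v /is_coboundaryP[x hx dx] /is_coboundaryP[y hy dy].
by apply/is_coboundaryP; exists (x - y); [exact: homogB | rewrite raddfB /= dx dy].
Qed.
HB.instance Definition _ :=
  GRing.isZmodClosed.Build cocycle is_coboundary is_coboundary_zmod_closed.

Definition cohom : zmodType := {ideal_quot is_coboundary}.

Definition cls (u : cocycle) : cohom := \pi_({ideal_quot is_coboundary}) u.

Lemma cls_surj (x : cohom) : exists u, x = cls u.
Proof. by exists (repr x); rewrite /cls reprK. Qed.

Lemma clsE (u v : cocycle) :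
  cls u = cls v <-> exists2 w : M, homog (i - 1) w & dif w = (u : M) - (v : M).
Proof.
split=> [/eqP|].
  by rewrite /cls -Quotient.idealrBE => /is_coboundaryP.
by move=> uv; apply/eqP; rewrite /cls -Quotient.idealrBE; apply/is_coboundaryP.
Qed.

Lemma clsB (u v : cocycle) : cls (u - v) = cls u - cls v.
Proof. by rewrite /cls !piE. Qed.

End Degree.

Definition mkCocycle (M : dgModule k) (i : int) (u : M)
  (hu : homog i u) (du : dif u = 0) : cocycle M i :=
  Cocycle (introT (is_cocycleP i u) (conj hu du)).

Lemma cocycle_homog (M : dgModule k) i (u : cocycle M i) : homog i (u : M).
Proof. by have /is_cocycleP[] := cvalP u. Qed.

Lemma cocycle_dif (M : dgModule k) i (u : cocycle M i) : dif (u : M) = 0.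
Proof. by have /is_cocycleP[] := cvalP u. Qed.

(* phi sends cocycles of M^i to cocycles of N^j, the rule [u] |-> [phi u] is  *)
(* well defined on cohomology, and it is an isomorphism H^i(M) -> H^j(N).     *)
Definition induces_iso (M N : dgModule k) (i j : int) (phi : M -> N) : Prop :=
  exists2 F : cohom M i -> cohom N j, bijective F &
    forall u : cocycle M i,
      exists2 v : cocycle N j, (v : N) = phi u & F (cls u) = cls v.

Record chainMap (M N : dgModule k) := ChainMap {
  cmap :> M -> N;
  cmap_linear : linear cmap;
  cmap_homog : forall i u, homog i u -> homog i (cmap u);
  cmap_dif : forall u, cmap (dif u) = dif (cmap u)
}.

End Cohomology.
Arguments cocycle {k} M i.
Arguments cohom {k} M i.

Section Fib.
Context {k : comPzRingType} (M N : dgModule k) (phi : chainMap M N).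

HB.instance Definition _ :=
  GRing.isLinear.Build k M N *:%R (@cmap k M N phi) (@cmap_linear k M N phi).

Definition fib_part (i : int) (x : M * N) : M * N :=
  (gpart i x.1, gpart (i - 1) x.2).
Definition fib_dif (x : M * N) : M * N :=
  (dif x.1, - phi x.1 - dif x.2).

Fact fib_part_linear i : linear (fib_part i).
Proof. by move=> a [x y] [x' y']; rewrite /fib_part /= !linearP. Qed.

Fact fib_part_part i j x :
  fib_part i (fib_part j x) = if i == j then fib_part j x else 0.
Proof.
rewrite /fib_part /= !gpart_gpart (inj_eq (addIr _)).
by case: (i == j).
Qed.

Lemma gpart_out (P : dgModule k) (u : P) (s : seq int) :
  u = \sum_(i <- s) gpart i u -> forall j, j \notin s -> gpart j u = 0.
Proof.
move=> us j js; rewrite us raddf_sum /= big_seq big1 // => i si.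
by rewrite gpart_gpart; case: eqP => // ji; rewrite ji si in js.
Qed.

Lemma gpart_sum_incl (P : dgModule k) (u : P) (s t : seq int) :
  uniq s -> uniq t -> {subset s <= t} -> u = \sum_(i <- s) gpart i u ->
  u = \sum_(i <- t) gpart i u.
Proof.
move=> Us Ut st us; rewrite {1}us.
rewrite [RHS](bigID (mem s)) /= [X in _ + X]big1 ?addr0; last first.
  by move=> j js; apply: gpart_out us _ js.
rewrite -[RHS]big_filter; apply: perm_big; apply: uniq_perm => //.
  exact: filter_uniq.
by move=> i; rewrite mem_filter; case si: (i \in s) => //=; rewrite st.
Qed.

Fact fib_part_sum x : exists2 s, uniq s & x = \sum_(i <- s) fib_part i x.
Proof.
case: x => x y.
have [s Us xs] := gpart_sum x; have [t Ut yt] := gpart_sum y.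
pose r := undup (s ++ [seq i + 1 | i <- t]).
have Ur : uniq r by exact: undup_uniq.
exists r => //.
have x1 : x = \sum_(i <- r) gpart i x.
  by apply: (gpart_sum_incl Us) => // i si; rewrite mem_undup mem_cat si.
have y1 : y = \sum_(i <- r) gpart (i - 1) y.
  rewrite -(big_map (fun i : int => i - 1) xpredT (fun i => gpart i y)).
  apply: (gpart_sum_incl Ut) => //; first by rewrite (map_inj_uniq (addIr _)).
  move=> i ti; apply/mapP; exists (i + 1); last by rewrite addrK.
  rewrite mem_undup mem_cat; apply/orP; right.
  exact: (map_f (fun i : int => i + 1)).
rewrite [LHS]surjective_pairing [RHS]surjective_pairing /=.
rewrite (raddf_sum fst) (raddf_sum snd) /=.
by rewrite -x1 -y1.
Qed.

Fact fib_dif_linear : linear fib_dif.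
Proof.
move=> a [x y] [x' y']; rewrite /fib_dif /= !linearP /=.
by congr (_, _); rewrite /= scalerBr addrACA !scalerN.
Qed.

Fact fib_dif_degree i x : fib_part i x = x -> fib_part (i + 1) (fib_dif x) = fib_dif x.
Proof.
case: x => x y; rewrite /fib_part /fib_dif /= => -[hx hy].
rewrite (dif_degree hx) addrK; congr (_, _).
rewrite raddfB raddfN /=.
have -> := cmap_homog phi hx.
by have := dif_degree hy; rewrite subrK => ->.
Qed.

Fact fib_dif_dif x : fib_dif (fib_dif x) = 0.
Proof.
case: x => x y; rewrite /fib_dif /= dif_dif; congr (_, _).
by rewrite raddfB raddfN /= dif_dif subr0 cmap_dif opprK addNr.
Qed.

Definition fib : dgModule k :=
  DgModule fib_part_linear fib_part_part fib_part_sum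
    fib_dif_linear fib_dif_degree fib_dif_dif.

End Fib.

(** * DG-categories *)

Record dgCat (k : comPzRingType) := DgCat {
  dg_ob :> Type;
  dg_hom : dg_ob -> dg_ob -> dgModule k;
  dg_id : forall X, dg_hom X X;
  dg_comp : forall X Y Z, dg_hom Y Z -> dg_hom X Y -> dg_hom X Z;
  dg_comp_linearl : forall X Y Z (f : dg_hom X Y),
    linear (fun g : dg_hom Y Z => dg_comp g f);
  dg_comp_linearr : forall X Y Z (g : dg_hom Y Z),
    linear (fun f : dg_hom X Y => dg_comp g f);
  dg_compA : forall X Y Z W
      (h : dg_hom Z W) (g : dg_hom Y Z) (f : dg_hom X Y),
    dg_comp h (dg_comp g f) = dg_comp (dg_comp h g) f;
  dg_comp1l : forall X Y (f : dg_hom X Y), dg_comp (dg_id Y) f = f;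
  dg_comp1r : forall X Y (f : dg_hom X Y), dg_comp f (dg_id X) = f;
  dg_id_homog : forall X, homog 0 (dg_id X);
  dg_comp_homog : forall X Y Z i j (g : dg_hom Y Z) (f : dg_hom X Y),
    homog i g -> homog j f -> homog (i + j) (dg_comp g f);
  dg_leibniz : forall X Y Z i (g : dg_hom Y Z) (f : dg_hom X Y),
    homog i g ->
    dif (dg_comp g f) =
      dg_comp (dif g) f + (-1) ^+ `|i|%N *: dg_comp g (dif f)
}.

Notation "g \oc f" := (dg_comp g f) (at level 40, left associativity).

Section DgCategories.
Context {k : comPzRingType} (A : dgCat k).
Implicit Types X Y Z W : A.

Local Notation "A( X , Y )" := (dg_hom X Y) (at level 0, format "A( X ,  Y )").

Definition nonpositive : Prop :=
  forall X Y (i : int) (u : A(X, Y)), 0 < i -> homog i u -> u = 0.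

(* Closed morphisms of degree 0. *)
Definition Z0 X Y := cocycle A(X, Y) 0.

Section Composition.
Variables (X Y Z : A).

Lemma oc0l (f : A(X, Y)) : (0 : A(Y, Z)) \oc f = 0.
Proof. exact: (linear_0 (dg_comp_linearl f)). Qed.
Lemma oc0r (g : A(Y, Z)) : g \oc (0 : A(X, Y)) = 0.
Proof. exact: (linear_0 (dg_comp_linearr g)). Qed.
Lemma ocDl (g g' : A(Y, Z)) (f : A(X, Y)) :
  (g + g') \oc f = g \oc f + g' \oc f.
Proof. exact: (linear_D (dg_comp_linearl f)). Qed.
Lemma ocDr (g : A(Y, Z)) (f f' : A(X, Y)) :
  g \oc (f + f') = g \oc f + g \oc f'.
Proof. exact: (linear_D (dg_comp_linearr g)). Qed.
Lemma ocBl (g g' : A(Y, Z)) (f : A(X, Y)) :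
  (g - g') \oc f = g \oc f - g' \oc f.
Proof. exact: (linear_B (dg_comp_linearl f)). Qed.
Lemma ocBr (g : A(Y, Z)) (f f' : A(X, Y)) :
  g \oc (f - f') = g \oc f - g \oc f'.
Proof. exact: (linear_B (dg_comp_linearr g)). Qed.

End Composition.

Fact postcomp_homog W X Y (g : Z0 X Y) i (u : A(W, X)) :
  homog i u -> homog i ((g : A(X, Y)) \oc u).
Proof. by rewrite -{2}(add0r i); apply: dg_comp_homog; exact: cocycle_homog. Qed.

Fact postcomp_dif W X Y (g : Z0 X Y) (u : A(W, X)) :
  (g : A(X, Y)) \oc dif u = dif ((g : A(X, Y)) \oc u).
Proof.
by rewrite (dg_leibniz _ (cocycle_homog g)) cocycle_dif oc0l add0r expr0 scale1r.
Qed.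

Definition postcomp W X Y (g : Z0 X Y) : chainMap A(W, X) A(W, Y) :=
  ChainMap (@dg_comp_linearr k A W X Y g)
    (@postcomp_homog W X Y g) (@postcomp_dif W X Y g).

Fact precomp_homog X Y W (f : Z0 X Y) i (u : A(Y, W)) :
  homog i u -> homog i (u \oc f).
Proof.
by move=> hu; rewrite -(addr0 i); apply: dg_comp_homog => //; exact: cocycle_homog.
Qed.

Fact precomp_dif X Y W (f : Z0 X Y) (u : A(Y, W)) :
  dif u \oc f = dif (u \oc f).
Proof.
suff homP i (v : A(Y, W)) : homog i v -> dif v \oc f = dif (v \oc f).
  have [s _ ->] := gpart_sum u.
  rewrite (linear_sum (dg_comp_linearl (f : A(X, Y)))) !raddf_sum /=.
  rewrite (linear_sum (dg_comp_linearl (f : A(X, Y)))).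
  by apply: eq_bigr => i _; apply: (homP i); rewrite /homog gpart_gpart eqxx.
by move=> hv; rewrite (dg_leibniz _ hv) cocycle_dif oc0r scaler0 addr0.
Qed.

Definition precomp X Y W (f : Z0 X Y) : chainMap A(Y, W) A(X, W) :=
  ChainMap (@dg_comp_linearl k A X Y W f)
    (@precomp_homog X Y W f) (@precomp_dif X Y W f).

Definition homotopy_complex X Y Z (f : Z0 X Y) (g : Z0 Y Z) (h : A(X, Z)) : Prop :=
  homog (-1) h /\ dif h = - ((g : A(Y, Z)) \oc (f : A(X, Y))).

Definition left_exact X Y Z (f : Z0 X Y) (g : Z0 Y Z) (h : A(X, Z)) : Prop :=
  homotopy_complex f g h /\
  forall W (i : int), i <= 0 ->
    @induces_iso k A(W, X) (fib (postcomp W g)) i i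
      (fun u => ((f : A(X, Y)) \oc u, h \oc u)).

(* The sign (-1)^|u| is (-1)^i, as only cocycles u of degree i matter. *)
Definition right_exact X Y Z (f : Z0 X Y) (g : Z0 Y Z) (h : A(X, Z)) : Prop :=
  homotopy_complex f g h /\
  forall W (i : int), i <= 0 ->
    @induces_iso k A(Z, W) (fib (precomp W f)) i i
      (fun u => (u \oc (g : A(Y, Z)), (-1) ^+ `|i|%N *: (u \oc h))).

Record loop X := Loop {
  loop_ob :> A;
  loop_map : A(loop_ob, X);
  loop_homog : homog (-1) loop_map;
  loop_closed : dif loop_map = 0;
  loop_iso : forall W (i : int), i <= 0 ->
    @induces_iso k A(W, loop_ob) A(W, X) i (i - 1) (fun u => loop_map \oc u)
}.

Record suspension X := Suspension {
  susp_ob :> A;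
  susp_map : A(X, susp_ob);
  susp_homog : homog (-1) susp_map;
  susp_closed : dif susp_map = 0;
  susp_iso : forall W (i : int), i <= 0 ->
    @induces_iso k A(susp_ob, W) A(X, W) i (i - 1) (fun u => u \oc susp_map)
}.

End DgCategories.

(** * Additive, triangulated and pretriangulated categories *)

Record preaddCat := PreaddCat {
  ob :> Type;
  mor : ob -> ob -> zmodType;
  idm : forall X, mor X X;
  mcomp : forall X Y Z, mor Y Z -> mor X Y -> mor X Z;
  mcompA : forall X Y Z W (h : mor Z W) (g : mor Y Z) (f : mor X Y),
    mcomp h (mcomp g f) = mcomp (mcomp h g) f;
  mcomp1l : forall X Y (f : mor X Y), mcomp (idm Y) f = f;
  mcomp1r : forall X Y (f : mor X Y), mcomp f (idm X) = f;
  mcompDl : forall X Y Z (g g' : mor Y Z) (f : mor X Y),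
    mcomp (g + g') f = mcomp g f + mcomp g' f;
  mcompDr : forall X Y Z (g : mor Y Z) (f f' : mor X Y),
    mcomp g (f + f') = mcomp g f + mcomp g f'
}.
Arguments idm {_} _.

Notation "g \oh f" := (mcomp g f) (at level 40, left associativity).

Definition opCat (C : preaddCat) : preaddCat :=
  @PreaddCat C (fun X Y => mor Y X) (@idm C) (fun X Y Z g f => f \oh g)
    (fun X Y Z W h g f => esym (mcompA f g h))
    (fun X Y f => mcomp1r f) (fun X Y f => mcomp1l f)
    (fun X Y Z g g' f => mcompDr f g g') (fun X Y Z g f f' => mcompDl f f' g).

Section Triangulated.
Variable C : preaddCat.
Implicit Types X Y Z : C.

Definition zero_object Z : Prop :=
  forall X, (forall f : mor X Z, f = 0) /\ (forall f : mor Z X, f = 0).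

Definition biproduct X Y P : Prop :=
  exists (i1 : mor X P) (i2 : mor Y P) (p1 : mor P X) (p2 : mor P Y),
    [/\ p1 \oh i1 = idm X, p2 \oh i2 = idm Y, p1 \oh i2 = 0, p2 \oh i1 = 0
      & i1 \oh p1 + i2 \oh p2 = idm P].

Definition additive_category : Prop :=
  (exists Z, zero_object Z) /\ (forall X Y, exists P, biproduct X Y P).

Definition isomorphism X Y (f : mor X Y) : Prop :=
  exists2 g : mor Y X, g \oh f = idm X & f \oh g = idm Y.

Record additive_functor (T : C -> C)
    (T1 : forall X Y, mor X Y -> mor (T X) (T Y)) : Prop := AdditiveFunctor {
  functor_id : forall X, T1 X X (idm X) = idm (T X);
  functor_comp : forall X Y Z (g : mor Y Z) (f : mor X Y),
    T1 X Z (g \oh f) = T1 Y Z g \oh T1 X Y f;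
  functor_add : forall X Y (f g : mor X Y), T1 X Y (f + g) = T1 X Y f + T1 X Y g
}.

(* D A C0 B h g f states that Om A -h-> C0 -g-> B -f-> A belongs to D, and    *)
(* N A B C0 f g h that A -f-> B -g-> C0 -h-> Sg A belongs to N.               *)
Definition left_class (Om : C -> C) :=
  forall A C0 B : C, mor (Om A) C0 -> mor C0 B -> mor B A -> Prop.
Definition right_class (Sg : C -> C) :=
  forall A B C0 : C, mor A B -> mor B C0 -> mor C0 (Sg A) -> Prop.

Section Left.
Variables (Om : C -> C) (Om1 : forall X Y, mor X Y -> mor (Om X) (Om Y)).
Arguments Om1 {X Y}.

Definition left_morphism A C0 B (h : mor (Om A) C0) (g : mor C0 B) (f : mor B A)
    A' C0' B' (h' : mor (Om A') C0') (g' : mor C0' B') (f' : mor B' A')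
    (c : mor C0 C0') (b : mor B B') (a : mor A A') : Prop :=
  [/\ c \oh h = h' \oh Om1 a, b \oh g = g' \oh c & a \oh f = f' \oh b].

Definition left_iso_closure (D : left_class Om) : left_class Om :=
  fun A C0 B h g f =>
    exists A' C0' B' (h' : mor (Om A') C0') (g' : mor C0' B') (f' : mor B' A')
           (c : mor C0' C0) (b : mor B' B) (a : mor A' A),
      [/\ D A' C0' B' h' g' f', isomorphism c, isomorphism b, isomorphism a
        & left_morphism h' g' f' h g f c b a].

Arguments left_iso_closure D A C0 B h g f : clear implicits.

Record left_triangulated (D : left_class Om) : Prop := LeftTriangulated {
  lt_additive : additive_category;
  lt_functor : additive_functor (@Om1);
  lt_iso : forall A C0 B (h : mor (Om A) C0) (g : mor C0 B) (f : mor B A),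
    left_iso_closure D A C0 B h g f -> D A C0 B h g f;
  (* Om O is again a zero object, Om being additive. *)
  lt1_id : forall O A : C, zero_object O -> D O A A 0 (idm A) 0;
  lt1_ex : forall B A (f : mor B A),
    exists C0 (h : mor (Om A) C0) (g : mor C0 B), D A C0 B h g f;
  lt2 : forall A C0 B (h : mor (Om A) C0) (g : mor C0 B) (f : mor B A),
    D A C0 B h g f -> D B (Om A) C0 (- Om1 f) h g;
  lt3 : forall A C0 B (h : mor (Om A) C0) (g : mor C0 B) (f : mor B A)
      A' C0' B' (h' : mor (Om A') C0') (g' : mor C0' B') (f' : mor B' A')
      (b : mor B B') (a : mor A A'),
    D A C0 B h g f -> D A' C0' B' h' g' f' -> a \oh f = f' \oh b ->
    exists c : mor C0 C0', left_morphism h g f h' g' f' c b a;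
  lt4 : forall A B C0 E F
      (f2 : mor (Om A) F) (f1 : mor F B) (f : mor B A)
      (g2 : mor (Om B) E) (g1 : mor E C0) (g : mor C0 B),
    D A F B f2 f1 f -> D B E C0 g2 g1 g ->
    exists G (v2 : mor (Om A) G) (v1 : mor G C0)
           (u2 : mor (Om F) E) (u1 : mor E G) (u : mor G F),
      [/\ D A G C0 v2 v1 (f \oh g), D F E G u2 u1 u
        & [/\ v1 \oh u1 = g1, f1 \oh u = g \oh v1, u \oh v2 = f2,
              u2 = g2 \oh Om1 f1 & u1 \oh g2 = v2 \oh Om1 f]]
}.

End Left.

End Triangulated.
Arguments left_iso_closure {C Om} Om1 D A C0 B h g f.

Section RightTriangulated.
Variables (C : preaddCat) (Sg : C -> C).
Variable Sg1 : forall X Y : C, mor X Y -> mor (Sg X) (Sg Y).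

Definition op_functor (X Y : opCat C) (f : mor X Y) : @mor (opCat C) (Sg X) (Sg Y) :=
  @Sg1 Y X f.

Definition op_class (N : right_class Sg) : @left_class (opCat C) Sg :=
  fun A C0 B h g f => N A B C0 f g h.

Definition right_triangulated (N : right_class Sg) : Prop :=
  left_triangulated op_functor (op_class N).

Definition right_iso_closure (N : right_class Sg) : right_class Sg :=
  fun A B C0 f g h =>
    exists A' B' C0' (f' : mor A' B') (g' : mor B' C0') (h' : mor C0' (Sg A'))
           (a : mor A' A) (b : mor B' B) (c : mor C0' C0),
      [/\ N A' B' C0' f' g' h', isomorphism a, isomorphism b, isomorphism c
        & [/\ b \oh f' = f \oh a, c \oh g' = g \oh b & Sg1 a \oh h' = h \oh c]].

End RightTriangulated.
Arguments right_iso_closure {C Sg} Sg1 N A B C0 f g h.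

Section Pretriangulated.
Variables (C : preaddCat) (Sg Om : C -> C).
Variable Sg1 : forall X Y : C, mor X Y -> mor (Sg X) (Sg Y).
Variable Om1 : forall X Y : C, mor X Y -> mor (Om X) (Om Y).
Variable adj : forall X Y : C, mor (Sg X) Y -> mor X (Om Y).
Arguments Sg1 {X Y}.
Arguments Om1 {X Y}.
Arguments adj {X Y}.

Definition adjunction : Prop :=
  (forall X Y : C, bijective (@adj X Y)) /\
  (forall (X' X Y Y' : C) (a : mor X' X) (f : mor (Sg X) Y) (b : mor Y Y'),
     adj (b \oh f \oh Sg1 a) = Om1 b \oh adj f \oh a).

Record pretriangulated (D : left_class Om) (N : right_class Sg) : Prop :=
  Pretriangulated {
  pt_adj : adjunction;
  pt_left : left_triangulated (@Om1) D;
  pt_right : right_triangulated (@Sg1) N;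
  pt_right_left :
    forall A B C0 (f : mor A B) (g : mor B C0) (h : mor C0 (Sg A))
      A' B' C0' (f' : mor (Om C0') A') (g' : mor A' B') (h' : mor B' C0')
      (a : mor A (Om C0')) (b : mor B A') (abar : mor (Sg A) C0'),
    N A B C0 f g h -> D C0' A' B' f' g' h' ->
    adj abar = a -> b \oh f = f' \oh a ->
    exists c : mor C0 B', c \oh g = g' \oh b /\ abar \oh h = h' \oh c;
  pt_left_right :
    forall A B C0 (f : mor A B) (g : mor B C0) (h : mor C0 (Sg A))
      A' B' C0' (f' : mor (Om C0') A') (g' : mor A' B') (h' : mor B' C0')
      (c : mor C0 B') (gam : mor (Sg A) C0') (gambar : mor A (Om C0')),
    N A B C0 f g h -> D C0' A' B' f' g' h' ->
    adj gam = gambar -> gam \oh h = h' \oh c ->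
    exists b : mor B A', b \oh f = f' \oh gambar /\ c \oh g = g' \oh b
}.

End Pretriangulated.

(** * The homotopy category and its triangles *)

Section HomotopyCategory.
Context {k : comPzRingType} (A : dgCat k).
Implicit Types X Y Z W : A.

Local Notation "A( X , Y )" := (dg_hom X Y) (at level 0, format "A( X ,  Y )").

Fact dg_id_closed X : dif (dg_id X) = 0.
Proof.
have := dg_leibniz (dg_id X) (dg_id_homog X).
rewrite dg_comp1r expr0 scale1r dg_comp1l dg_comp1r => /eqP.
by rewrite addrC -subr_eq subrr => /eqP<-.
Qed.

Definition zid X : Z0 X X := mkCocycle (dg_id_homog X) (dg_id_closed X).

Fact zcomp_dif X Y Z (g : Z0 Y Z) (f : Z0 X Y) :
  dif ((g : A(Y, Z)) \oc (f : A(X, Y))) = 0.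
Proof. by rewrite -precomp_dif cocycle_dif oc0l. Qed.

Definition zcomp X Y Z (g : Z0 Y Z) (f : Z0 X Y) : Z0 X Z :=
  mkCocycle (postcomp_homog g (cocycle_homog f)) (zcomp_dif g f).

Lemma zcomp_cls X Y Z (g g' : Z0 Y Z) (f f' : Z0 X Y) :
  cls g = cls g' -> cls f = cls f' -> cls (zcomp g f) = cls (zcomp g' f').
Proof.
move=> /clsE[w hw dw] /clsE[v hv dv]; apply/clsE.
exists (w \oc (f : A(X, Y)) + (g' : A(Y, Z)) \oc v).
  rewrite /homog raddfD /=.
  have -> := precomp_homog f hw.
  by have -> := postcomp_homog g' hv.
rewrite raddfD /= -precomp_dif -postcomp_dif dw dv ocBl ocBr /=.
by rewrite addrA subrK.
Qed.

Definition hcomp X Y Z (g : cohom A(Y, Z) 0) (f : cohom A(X, Y) 0) :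
  cohom A(X, Z) 0 := cls (zcomp (repr g) (repr f)).

Lemma hcompE X Y Z (g : Z0 Y Z) (f : Z0 X Y) :
  hcomp (cls g) (cls f) = cls (zcomp g f).
Proof. by apply: zcomp_cls; rewrite /cls reprK. Qed.

Lemma clsD X Y (f g : Z0 X Y) : cls (f + g) = cls f + cls g.
Proof. by rewrite /cls !piE. Qed.

Fact hcompA X Y Z W (h : cohom A(Z, W) 0) (g : cohom A(Y, Z) 0)
  (f : cohom A(X, Y) 0) : hcomp h (hcomp g f) = hcomp (hcomp h g) f.
Proof.
have [h' ->] := cls_surj h; have [g' ->] := cls_surj g.
have [f' ->] := cls_surj f; rewrite !hcompE; congr cls.
by apply: val_inj; rewrite /= dg_compA.
Qed.

Fact hcomp1l X Y (f : cohom A(X, Y) 0) : hcomp (cls (zid Y)) f = f.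
Proof.
have [f' ->] := cls_surj f; rewrite hcompE; congr cls.
by apply: val_inj; rewrite /= dg_comp1l.
Qed.

Fact hcomp1r X Y (f : cohom A(X, Y) 0) : hcomp f (cls (zid X)) = f.
Proof.
have [f' ->] := cls_surj f; rewrite hcompE; congr cls.
by apply: val_inj; rewrite /= dg_comp1r.
Qed.

Fact hcompDl X Y Z (g g' : cohom A(Y, Z) 0) (f : cohom A(X, Y) 0) :
  hcomp (g + g') f = hcomp g f + hcomp g' f.
Proof.
have [h ->] := cls_surj g; have [h' ->] := cls_surj g'.
have [e ->] := cls_surj f; rewrite !hcompE -!clsD hcompE; congr cls.
by apply: val_inj; rewrite /= ocDl.
Qed.

Fact hcompDr X Y Z (g : cohom A(Y, Z) 0) (f f' : cohom A(X, Y) 0) :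
  hcomp g (f + f') = hcomp g f + hcomp g f'.
Proof.
have [h ->] := cls_surj f; have [h' ->] := cls_surj f'.
have [e ->] := cls_surj g; rewrite !hcompE -!clsD hcompE; congr cls.
by apply: val_inj; rewrite /= ocDr.
Qed.

Definition H0 : preaddCat :=
  @PreaddCat A (fun X Y => cohom A(X, Y) 0) (fun X => cls (zid X)) hcomp
    hcompA hcomp1l hcomp1r hcompDl hcompDr.

Definition preabelian : Prop :=
  [/\ additive_category H0,
      forall (Y Z : A) (g : Z0 Y Z),
        exists X (f : Z0 X Y) (h : A(X, Z)), left_exact f g h
    & forall (X Y : A) (f : Z0 X Y),
        exists Z (g : Z0 Y Z) (h : A(X, Z)), right_exact f g h].

Variables (L : forall X, loop X) (S : forall X, suspension X).

Definition loop_obj (X : H0) : H0 := loop_ob (L X).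
Definition susp_obj (X : H0) : H0 := susp_ob (S X).

(* Every morphism of H0 is some [cls f], so this equivalence determines Om1.  *)
Definition is_loop_functor
    (Om1 : forall X Y : H0, mor X Y -> mor (loop_obj X) (loop_obj Y)) : Prop :=
  forall X Y (f : Z0 X Y) (f' : Z0 (L X) (L Y)),
    Om1 X Y (cls f) = cls f' <->
    exists2 t : A(L X, Y), homog (-2) t &
      dif t = loop_map (L Y) \oc (f' : A(L X, L Y))
              - (f : A(X, Y)) \oc loop_map (L X).

Definition is_suspension_functor
    (Sg1 : forall X Y : H0, mor X Y -> mor (susp_obj X) (susp_obj Y)) : Prop :=
  forall X Y (f : Z0 X Y) (f' : Z0 (S X) (S Y)),
    Sg1 X Y (cls f) = cls f' <->
    exists2 t : A(X, S Y), homog (-2) t &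
      dif t = (f' : A(S X, S Y)) \oc susp_map (S X)
              - susp_map (S Y) \oc (f : A(X, Y)).

Definition is_suspension_loop_adjunction
    (adj : forall X Y : H0, mor (susp_obj X) Y -> mor X (loop_obj Y)) : Prop :=
  forall X Y (f : Z0 (S X : A) Y) (f' : Z0 X (L Y)),
    adj X Y (cls f) = cls f' <->
    exists2 t : A(X, Y), homog (-2) t &
      dif t = (f : A(S X, Y)) \oc susp_map (S X)
              + loop_map (L Y) \oc (f' : A(X, L Y)).

Definition standard_left : left_class loop_obj :=
  fun (A0 A2 A1 : A) (f2 : cohom A(L A0, A2) 0)
      (f1 : cohom A(A2, A1) 0) (f0 : cohom A(A1, A0) 0) =>
  exists (z2 : Z0 (L A0) A2) (z1 : Z0 A2 A1) (z0 : Z0 A1 A0)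
         (hf0 : A(A2, A0)) (hf1 : A(L A0, A1)) (eta : A(L A0, A0)),
  [/\ [/\ f2 = cls z2, f1 = cls z1 & f0 = cls z0],
      left_exact z1 z0 hf0,
      homog (-1) hf1 /\ dif hf1 = - ((z1 : A(A2, A1)) \oc (z2 : A(L A0, A2)))
    & homog (-2) eta /\
      dif eta = (z0 : A(A1, A0)) \oc hf1 - hf0 \oc (z2 : A(L A0, A2))
                - loop_map (L A0)].

Definition standard_right : right_class susp_obj :=
  fun (A0 A1 A2 : A) (f0 : cohom A(A0, A1) 0)
      (f1 : cohom A(A1, A2) 0) (f2 : cohom A(A2, S A0) 0) =>
  exists (z0 : Z0 A0 A1) (z1 : Z0 A1 A2) (z2 : Z0 A2 (S A0))
         (hf0 : A(A0, A2)) (hf1 : A(A1, S A0)) (eta : A(A0, S A0)),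
  [/\ [/\ f0 = cls z0, f1 = cls z1 & f2 = cls z2],
      right_exact z0 z1 hf0,
      homog (-1) hf1 /\ dif hf1 = - ((z2 : A(A2, S A0)) \oc (z1 : A(A1, A2)))
    & homog (-2) eta /\
      dif eta = susp_map (S A0) + (z2 : A(A2, S A0)) \oc hf0
                - hf1 \oc (z0 : A(A0, A1))].

End HomotopyCategory.
Arguments standard_left {k A} L _ _ _ _ _ _.
Arguments standard_right {k A} S _ _ _ _ _ _.

(* Main.v *)
(* An exactness condition on H^i for all i <= 0 means that the cone of a chain *)
(* map is acyclic in a range of degrees (non-positivity of A deals with the    *)
(* top degree), so that any closed element can be lifted together with its     *)
(* homotopies.  Each axiom of a left triangulated category then amounts to a   *)
(* few liftings, whose hypotheses are identities between composites following  *)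
(* from the Leibniz rule alone; in particular the octahedral axiom holds for   *)
(* an arbitrary homotopy kernel of the composite.  Kernels are invariant under *)
(* homotopy equivalence, hence standard triangles are already closed under     *)
(* isomorphism.  The right triangulation is the left triangulation of the      *)
(* opposite DG-category, where the differential is multiplied by (-1)^i in     *)
(* degree i, while homotopies of complexes and suspension maps change sign.    *)

Require Import Defs.
From mathcomp Require Import all_boot all_order all_algebra.
From mathcomp Require Import boolp zify.

Set Implicit Arguments.
Unset Strict Implicit.
Unset Printing Implicit Defensive.

Import Order.TTheory GRing.Theory Num.Theory.
Local Open Scope ring_scope.

(** * Linear identities in abelian groups *)

(** The guiding picture is the homotopy fibre sequence: the loop object of X is the homotopy kernel
    of 0 -> X, and a standard left triangle is the start of the fibre sequence of its last map.
    Cohomology is left as early as possible. By [left_exactP] and [is_loop_of], a cocycle of the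
    relevant cone, given by elements [u], [m], [n], bounds explicit elements [r], [s], [t]. With
    [u = 0] in degree 0 this lifts a closed map together with a homotopy ([kernel_lift],
    [loop_lift]); one degree lower it makes a closed map null-homotopic ([kernel_inj], [loop_inj]).

    Completion, rotation, fill-in and the octahedron ([triangle_exists], [triangle_rotate],
    [triangle_map], [octahedron]) are chains of such liftings. Isomorphisms in the homotopy category
    come from homotopy equivalences, along which triangles are transported ([triangle_iso_base],
    [triangle_iso_fiber]). [triangles_left_triangulated] collects this for any category presented by
    homotopy classes, so that it applies both to A and to the opposite DG-category, where
    [op_kernelP], [op_loopP] and [standard_rightE] identify the dual notions.

    The two ladder conditions mix both kinds of triangles and are proved directly ([ladder_right],
    [ladder_left]): a lifting gives the missing map and one square, an injectivity statement the
    other square, and the homotopy expressing adjointness joins the two ends. *)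

Module Zmod.

Inductive expr := Zero | Var of nat | Add of expr & expr | Opp of expr.

Section Eval.
Variable V : zmodType.

Fixpoint eval (env : seq V) (e : expr) : V :=
  match e with
  | Zero => 0
  | Var n => nth 0 env n
  | Add a b => eval env a + eval env b
  | Opp a => - eval env a
  end.

Fixpoint coef (i : nat) (e : expr) : int :=
  match e with
  | Zero => 0
  | Var n => if n == i then 1 else 0
  | Add a b => coef i a + coef i b
  | Opp a => - coef i a
  end.

Lemma evalE env e : eval env e = \sum_(i < size env) env`_i *~ coef i e.
Proof.
elim: e => [|n|a IHa b IHb|a IHa] /=.
- by rewrite big1.
- case: (ltnP n (size env)) => hn.
    rewrite (bigD1 (Ordinal hn)) //= eqxx mulr1z big1 ?addr0 // => i.
    by rewrite eq_sym -val_eqE /= => /negbTE ->.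
  rewrite nth_default // big1 // => i _.
  by case: eqP => // e; move: (ltn_ord i); rewrite -e ltnNge hn.
- by rewrite IHa IHb -big_split; apply: eq_bigr => i _; rewrite mulrzDr.
- by rewrite IHa -sumrN; apply: eq_bigr => i _; rewrite mulrNz.
Qed.

(** Both sides are integer combinations of the atoms, and comparing the coefficients is a closed
    boolean computation whatever the group. *)
Lemma eval_eq env e1 e2 :
  all (fun i => coef i e1 == coef i e2) (iota 0 (size env)) ->
  eval env e1 = eval env e2.
Proof.
move=> /allP h; rewrite !evalE; apply: eq_bigr => i _.
by congr (_ *~ _); apply/eqP/h; rewrite mem_iota ltn_ord.
Qed.

End Eval.

End Zmod.

(** Atoms are matched up to unification, so that convertible forms of one morphism share a
    variable. *)
Ltac zmod_index x env :=
  match env with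
  | x :: _ => constr:(0%N)
  | ?y :: _ => let _ := match goal with _ => unify x y end in constr:(0%N)
  | _ :: ?env' => let n := zmod_index x env' in constr:(n.+1)
  end.

Ltac zmod_atoms e env :=
  lazymatch e with
  | @GRing.add _ ?a ?b => let env := zmod_atoms a env in zmod_atoms b env
  | @GRing.opp _ ?a => zmod_atoms a env
  | @GRing.zero _ => env
  | _ => match env with
         | _ => let n := zmod_index e env in env
         | _ => constr:(e :: env)
         end
  end.

Ltac zmod_reify e env :=
  lazymatch e with
  | @GRing.add _ ?a ?b =>
    let a := zmod_reify a env in let b := zmod_reify b env in
    constr:(Zmod.Add a b)
  | @GRing.opp _ ?a => let a := zmod_reify a env in constr:(Zmod.Opp a)
  | @GRing.zero _ => constr:(Zmod.Zero)
  | _ => let n := zmod_index e env in constr:(Zmod.Var n)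
  end.

Ltac zmod :=
  lazymatch goal with
  | |- @eq ?V ?a ?b =>
    let env := zmod_atoms a (@nil V) in
    let env := zmod_atoms b env in
    let ea := zmod_reify a env in
    let eb := zmod_reify b env in
    exact (@Zmod.eval_eq _ env ea eb isT)
  end.

Local Notation "A( X , Y )" := (dg_hom X Y) (at level 0, format "A( X ,  Y )").

(** * Calculus of graded maps *)

Section Signs.
Context {k : comPzRingType}.

Definition sgn (i : int) : k := (-1) ^+ `|i|%N.

Lemma sgnD i j : sgn (i + j) = sgn i * sgn j.
Proof.
rewrite /sgn -signr_odd -[X in _ = X * _]signr_odd -[X in _ = _ * X]signr_odd.
rewrite -signr_addb; congr (_ ^+ _); congr nat_of_bool; lia.
Qed.

Lemma sgn1 : sgn 1 = -1. Proof. by rewrite /sgn expr1. Qed.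

Lemma sgn_pred i : - sgn (i - 1) = sgn i.
Proof. by rewrite -[in RHS](subrK 1 i) (sgnD (i - 1)) sgn1 mulrN1. Qed.

Lemma sgnn i : sgn i * sgn i = 1.
Proof. by rewrite /sgn -expr2 -exprM mulnC exprM sqrrN expr1n expr1n. Qed.

Lemma sgnB1 i : sgn (i - 1) = - sgn i.
Proof. by rewrite -[in RHS](sgn_pred i) opprK. Qed.

Lemma sgnB2 i : sgn (i - 2) = sgn i.
Proof. by rewrite -[i - 2]/(i - (1 + 1)) opprD addrA !sgnB1 opprK. Qed.

Lemma sgnD1 i : sgn (i + 1) = - sgn i.
Proof. by rewrite -[in RHS](addrK 1 i) (sgnB1 (i + 1)) opprK. Qed.

Lemma sgn0 : sgn 0 = 1. Proof. by []. Qed.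

Lemma sgnN1 : sgn (-1) = -1. Proof. by rewrite /sgn expr1. Qed.

Lemma sgnN2 : sgn (-2) = 1.
Proof. by rewrite /sgn sqrrN expr1n. Qed.

End Signs.

Section GradedCalculus.
Context {k : comPzRingType}.

Section Modules.
Variable M : dgModule k.
Implicit Types u v : M.

Definition is_closed i u : Prop := homog i u /\ dif u = 0.

Lemma dif0 : dif (0 : M) = 0. Proof. exact: raddf0. Qed.

Lemma difD u v : dif (u + v) = dif u + dif v. Proof. exact: raddfD. Qed.

Lemma difN u : dif (- u) = - dif u. Proof. exact: raddfN. Qed.

Lemma difZ a u : dif (a *: u) = a *: dif u. Proof. exact: linearZ. Qed.

Lemma homogD i u v : homog i u -> homog i v -> homog i (u + v).
Proof. by rewrite /homog raddfD /= => -> ->. Qed.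

Lemma homogN i u : homog i u -> homog i (- u).
Proof. by rewrite /homog raddfN /= => ->. Qed.

Lemma homogZ i a u : homog i u -> homog i (a *: u).
Proof. by rewrite /homog linearZ /= => ->. Qed.

Lemma scale_sgnn i u : sgn i *: (sgn i *: u) = u.
Proof. by rewrite scalerA sgnn scale1r. Qed.

Lemma closed_cocycle i (u : cocycle M i) : is_closed i (u : M).
Proof. by split; [exact: cocycle_homog | exact: cocycle_dif]. Qed.

End Modules.

Section Composition.
Variables (A : dgCat k) (X Y Z : A).
Implicit Types (g : A(Y, Z)) (f : A(X, Y)).

Lemma ocNl g f : (- g) \oc f = - (g \oc f).
Proof. by rewrite -sub0r ocBl oc0l sub0r. Qed.

Lemma ocNr g f : g \oc (- f) = - (g \oc f).
Proof. by rewrite -sub0r ocBr oc0r sub0r. Qed.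

Lemma ocZl a g f : (a *: g) \oc f = a *: (g \oc f).
Proof. by have := dg_comp_linearl f a g 0; rewrite /= oc0l !addr0. Qed.

Lemma ocZr a g f : g \oc (a *: f) = a *: (g \oc f).
Proof. by have := dg_comp_linearr g a f 0; rewrite /= oc0r !addr0. Qed.

Lemma leibniz_even i g f :
  homog i g -> ~~ odd `|i|%N -> dif (g \oc f) = dif g \oc f + g \oc dif f.
Proof.
by move=> hg /negbTE hi; rewrite (dg_leibniz _ hg) -signr_odd hi scale1r.
Qed.

Lemma leibniz_odd i g f :
  homog i g -> odd `|i|%N -> dif (g \oc f) = dif g \oc f - g \oc dif f.
Proof.
by move=> hg hi; rewrite (dg_leibniz _ hg) -signr_odd hi expr1 scaleN1r.
Qed.

Lemma leibniz_sgn i g f :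
  homog i g -> dif (g \oc f) = dif g \oc f + sgn i *: (g \oc dif f).
Proof. exact: dg_leibniz. Qed.

(** Stated backwards: the target degree and that of the first factor fix the degree left for the
    rest, which lets [degree] walk down a composite. *)
Lemma homog_comp i j g f : homog i g -> homog (j - i) f -> homog j (g \oc f).
Proof. by move=> hg hf; rewrite -(subrK i j) addrC; apply: dg_comp_homog. Qed.

End Composition.

End GradedCalculus.

Ltac oc_norm :=
  repeat progress rewrite ?ocDl ?ocDr ?ocNl ?ocNr ?ocZl ?ocZr ?oc0l ?oc0r
    ?dg_comp1l ?dg_comp1r -?dg_compA.

(* Each composite is right-associated, and the degree of its first factor is  *)
(* read off the context.                                                      *)
Ltac degree :=
  lazymatch goal with
  | |- homog _ (@GRing.add _ _ _) => apply: homogD; degree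
  | |- homog _ (@GRing.opp _ _) => apply: homogN; degree
  | |- homog _ (@GRing.scale _ _ _ _) => apply: homogZ; degree
  | |- homog _ (@GRing.zero _) => exact: homog0
  | |- homog _ (dg_id _) => exact: dg_id_homog
  | |- homog _ (?g \oc _) =>
    match goal with H : homog _ g |- _ => apply: (homog_comp H); degree end
  | |- homog ?j ?f =>
    match goal with H : homog ?i f |- _ =>
      first [exact: H | (have -> : j = i by lia); exact: H] end
  end.

Ltac dif_step :=
  match goal with
  | |- context [dif (?g \oc ?f)] =>
    match goal with H : homog _ g |- _ =>
      first [rewrite (leibniz_even f H isT) | rewrite (leibniz_odd f H isT)
            | rewrite (leibniz_sgn f H)]
    end
  | H : dif ?v = _ |- context [dif ?v] => rewrite !H
  end.

Ltac dif_norm :=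
  repeat progress (oc_norm; rewrite ?difD ?difN ?difZ ?dif0 ?dg_id_closed
    ?sgnB1 ?sgnB2 ?sgnD1 ?sgn0 ?sgnN1 ?scaleNr ?scale1r ?scalerDr ?scalerN
    ?scale_sgnn ?scaler0;
    repeat dif_step).

(* Proves an identity between differentials and composites by expanding both  *)
(* sides with the Leibniz rule and the equations [dif v = _] of the context,  *)
(* and comparing coefficients; degree and index goals are solved as well.     *)
Ltac dg :=
  repeat match goal with H : is_closed _ _ |- _ => case: H => ? ? end;
  lazymatch goal with
  | |- homog _ _ => oc_norm; degree
  | |- is_closed _ _ => split; [oc_norm; degree | dif_norm; zmod]
  | |- @eq _ _ _ => dif_norm; zmod
  | |- _ => by lia
  end.

(** * Kernels, loops and triangles *)

Section Triangles.
Context {k : comPzRingType} (A : dgCat k).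
Implicit Types X Y Z W : A.

(* Up to sign, [u |-> l u] commutes with the differentials; the condition says  *)
(* that its cone is acyclic in the degrees [i <= 0], which combines the         *)
(* surjectivity and the injectivity on cohomology.                              *)
Definition is_loop X O (l : A(O, X)) : Prop :=
  [/\ homog (-1) l, dif l = 0 &
    forall W i (u : A(W, O)) (m : A(W, X)), i <= 0 ->
      homog (i + 1) u -> homog (i - 1) m -> dif u = 0 -> dif m = - (l \oc u) ->
      exists r t, [/\ homog i r, homog (i - 2) t, dif r = u
        & dif t = l \oc r - m]].

(* The same cone condition for [u |-> (f u, h u)] with values in Fib(g). *)
Definition is_kernel X Y Z (f : A(X, Y)) (g : A(Y, Z)) (h : A(X, Z)) : Prop :=
  [/\ is_closed 0 f, is_closed 0 g, homog (-1) h, dif h = - (g \oc f) &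
    forall W i (u : A(W, X)) (m : A(W, Y)) (n : A(W, Z)), i <= 0 ->
      homog (i + 1) u -> homog i m -> homog (i - 1) n ->
      dif u = 0 -> dif m = f \oc u -> dif n = - (g \oc m) - h \oc u ->
      exists r s t, [/\ [/\ homog i r, homog (i - 1) s & homog (i - 2) t],
        dif r = u, dif s = f \oc r - m & dif t = n - g \oc s - h \oc r]].

Definition is_triangle O A2 A1 A0 (l : A(O, A0)) (f2 : A(O, A2)) (f1 : A(A2, A1))
    (f0 : A(A1, A0)) (h : A(A2, A0)) (h1 : A(O, A1)) (e : A(O, A0)) : Prop :=
  [/\ is_kernel f1 f0 h, is_closed 0 f2,
      homog (-1) h1 /\ dif h1 = - (f1 \oc f2)
    & homog (-2) e /\ dif e = f0 \oc h1 - h \oc f2 - l].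

Lemma loop_lift X O (l : A(O, X)) W i (v : A(W, X)) :
  is_loop l -> i <= 0 -> homog (i - 1) v -> dif v = 0 ->
  exists u t, [/\ homog i u, dif u = 0, homog (i - 2) t & dif t = l \oc u - v].
Proof.
move=> [hl dl lP] i0 hv dv.
have [||||r [t [hr ht dr dt]]] := lP W i 0 v i0; try dg.
by exists r, t.
Qed.

Lemma loop_inj X O (l : A(O, X)) W (u : A(W, O)) (t : A(W, X)) :
  is_loop l -> is_closed 0 u -> homog (-2) t -> dif t = l \oc u ->
  exists2 w, homog (-1) w & dif w = u.
Proof.
move=> [hl dl lP] [hu du] ht dt.
have [|||||r [_ [hr _ dr _]]] := lP W (-1) u (- t); try dg.
by exists r.
Qed.

Lemma kernel_lift X Y Z (f : A(X, Y)) (g : A(Y, Z)) h W m (n : A(W, Z)) :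
  is_kernel f g h -> is_closed 0 m -> homog (-1) n -> dif n = - (g \oc m) ->
  exists c s t, [/\ is_closed 0 c, homog (-1) s, homog (-2) t,
    dif s = f \oc c - m & dif t = n - g \oc s - h \oc c].
Proof.
move=> [[hf df] [hg dg'] hh dh kP] [hm dm] hn dn.
have [|||||||c [s [t [[hc hs ht] dc ds dt]]]] := kP W 0 0 m n; try dg.
by exists c, s, t.
Qed.

Lemma kernel_inj X Y Z (f : A(X, Y)) (g : A(Y, Z)) h W u s (t : A(W, Z)) :
  is_kernel f g h -> is_closed 0 u -> homog (-1) s -> homog (-2) t ->
  dif s = f \oc u -> dif t = - (g \oc s) - h \oc u ->
  exists2 w, homog (-1) w & dif w = u.
Proof.
move=> [[hf df] [hg dg'] hh dh kP] [hu du] hs ht ds dt.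
have [|||||||r [_ [_ [[hr _ _] dr _ _]]]] := kP W (-1) u s t; try dg.
by exists r.
Qed.

(** The pair (0, - l) is a cocycle of the fibre of [f0]. Its lift to the kernel is the connecting
    map [f2], and the homotopies of the lift are [- h1] and [e]. *)
Lemma triangle_exists O A2 A1 A0 (l : A(O, A0)) (f1 : A(A2, A1))
    (f0 : A(A1, A0)) h :
  is_loop l -> is_kernel f1 f0 h -> exists f2 h1 e, is_triangle l f2 f1 f0 h h1 e.
Proof.
move=> [hl dl _] kP.
have [|||f2 [s [t [hf2 hs ht ds dt]]]] :=
  kernel_lift (m := 0) (n := - l) kP; try dg.
case: (kP) => [[hf1 df1] [hf0 df0] hh dh _].
by exists f2, (- s), t; split=> //; split; dg.
Qed.

(** The homotopies [h] and [q] make [b \oc f1] a cocycle of the fibre of [f0'], which lifts to [c].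
    The square of connecting maps then commutes by injectivity for the same kernel; [p] exhibits
    [a'] as the loop of [a]. *)
Lemma triangle_map
    O A2 A1 A0 (l : A(O, A0)) f2 (f1 : A(A2, A1)) (f0 : A(A1, A0)) h h1 e
    O' A2' A1' A0' (l' : A(O', A0')) f2' (f1' : A(A2', A1')) (f0' : A(A1', A0'))
    h' h1' e'
    (b : A(A1, A1')) (a : A(A0, A0')) (a' : A(O, O')) q p :
  is_triangle l f2 f1 f0 h h1 e -> is_triangle l' f2' f1' f0' h' h1' e' ->
  is_closed 0 a -> is_closed 0 b -> is_closed 0 a' ->
  homog (-1) q -> dif q = a \oc f0 - f0' \oc b ->
  homog (-2) p -> dif p = l' \oc a' - a \oc l ->
  exists c s t w,
   [/\ is_closed 0 c,
       homog (-1) s /\ dif s = f1' \oc c - b \oc f1,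
       homog (-2) t /\ dif t = a \oc h + q \oc f1 - f0' \oc s - h' \oc c
     & homog (-1) w /\ dif w = c \oc f2 - f2' \oc a'].
Proof.
move=> [k1 [hf2 df2] [hh1 dh1] [he de]] [k1' [hf2' df2'] [hh1' dh1'] [he' de']].
move=> [ha da] [hb db] [ha' da'] hq dq hp dp.
case: (k1) => [[hf1 df1] [hf0 df0] hh dh _].
case: (k1') => [[hf1' df1'] [hf0' df0'] hh' dh' _].
have [|||c [s [t [[hc dc] hs ht ds dt]]]] :=
  kernel_lift (m := b \oc f1) (n := a \oc h + q \oc f1) k1'; try dg.
have [|||||w hw dw] := kernel_inj (u := c \oc f2 - f2' \oc a')
  (s := s \oc f2 - b \oc h1 + h1' \oc a')
  (t := a \oc e - e' \oc a' - p + t \oc f2 - q \oc h1) k1'; try dg.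
by exists c, s, t, w.
Qed.

(** The fibre of the fibre inclusion [f1] is the loop object of the base; [w] represents the loop of
    [f0]. *)
Lemma triangle_rotate O A2 A1 A0 (l : A(O, A0)) f2 (f1 : A(A2, A1))
    (f0 : A(A1, A0)) h h1 e O1 (l1 : A(O1, A1)) (w : A(O1, O)) p :
  is_triangle l f2 f1 f0 h h1 e -> is_loop l -> is_loop l1 ->
  is_closed 0 w -> homog (-2) p -> dif p = l \oc w - f0 \oc l1 ->
  exists (h1' : A(O1, A2)) (e' : A(O1, A1)),
    is_triangle l1 (- w) f2 f1 h1 h1' e'.
Proof.
move=> [k1 cf2 [hh1 dh1] [he de]] lP [hl1 dl1 _] [hw dw] hp dp.
case: (k1) => cf1 cf0 hh dh kP; case: (lP) => hl dl uP.
case: (cf2) (cf1) (cf0) => hf2 df2 [hf1 df1] [hf0 df0].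
(* Since [f1 \oc f2 \oc w] bounds [- (h1 \oc w)], lifting in degree -1 gives both homotopies of the
   rotated triangle at once. *)
have [|||||||h1' [e' [t [[hh1' he' _] dh1' de' _]]]] := kP O1 (-1) (f2 \oc w)
  (l1 - h1 \oc w) (e \oc w + p); try dg.
exists h1', e'; split; [| dg | split; dg | split; dg].
split=> // W i u m n i0 hu hm hn du dm dn.
(* Pushed to [A0], the cocycle (u, m, n) becomes one for the loop map, which provides [r]; the
   kernel of [f0] then corrects the other components one degree lower. *)
have [||||r [T [hr hT dr dT]]] :=
  uP W i u (f0 \oc n - h \oc m + e \oc u) i0; try dg.
have [|||||||s [t' [q [[hs ht' hq] ds dt' dq]]]] := kP W (i - 1) (f2 \oc r - m)
  (n - h1 \oc r) (T + e \oc r); try dg.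
by exists r, s, (- t'); split; [split|..]; dg.
Qed.

(** The maps [u] and [u1] are fill-ins over (id, g) and (f, id); [wf] and [wf1] represent the loops
    of [f] and [f1]. Everything else is lifted through the three given kernels. *)
Lemma octahedron OX OY OF X Y Z D E F
    (lX : A(OX, X)) (lY : A(OY, Y)) (lF : A(OF, F))
    (f2 : A(OX, F)) (f1 : A(F, Y)) (f : A(Y, X)) hf hf1 ef
    (g2 : A(OY, E)) (g1 : A(E, Z)) (g : A(Z, Y)) hg hg1 eg
    (v2 : A(OX, D)) (v1 : A(D, Z)) hv hv1 ev
    (wf : A(OY, OX)) pf (wf1 : A(OF, OY)) pf1 :
  is_triangle lX f2 f1 f hf hf1 ef -> is_triangle lY g2 g1 g hg hg1 eg ->
  is_triangle lX v2 v1 (f \oc g) hv hv1 ev ->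
  is_loop lX -> is_loop lY -> is_loop lF ->
  is_closed 0 wf -> homog (-2) pf -> dif pf = lX \oc wf - f \oc lY ->
  is_closed 0 wf1 -> homog (-2) pf1 -> dif pf1 = lY \oc wf1 - f1 \oc lF ->
  exists (u : A(D, F)) (u1 : A(E, D)) hu hu1 eu s s1 w w1,
  [/\ is_triangle lF (g2 \oc wf1) u1 u hu hu1 eu,
      homog (-1) s /\ dif s = f1 \oc u - g \oc v1,
      homog (-1) s1 /\ dif s1 = v1 \oc u1 - g1,
      homog (-1) w /\ dif w = u \oc v2 - f2
    & homog (-1) w1 /\ dif w1 = u1 \oc g2 - v2 \oc wf].
Proof.
move=> TF TE TD LX LY LF cwf hpf dpf cwf1 hpf1 dpf1.
case: (LX) (LY) (LF) => hlX dlX _ [hlY dlY _] [hlF dlF _].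
case: (TF) => KF [hf2 df2] [hhf1 dhf1] [hef def].
case: (TE) => KE [hg2 dg2] [hhg1 dhg1] [heg deg].
case: (TD) => KD [hv2 dv2] [hhv1 dhv1] [hev dev].
case: (KF) => cf1 cf hhf dhf PF; case: (KE) => cg1 cg hhg dhg PE.
case: (KD) => cv1 cfg hhv dhv PD.
have [|||||||u [s [t [w [[hu du] [hs ds] [ht dt] [hw dw]]]]]] :=
  triangle_map (a := dg_id X) (a' := dg_id OX) (b := g) (q := 0) (p := 0) TD TF;
  try dg.
have [|||||||u1 [s1 [t1 [w1 [[hu1 du1] [hs1 ds1] [ht1 dt1] [hw1 dw1]]]]]] :=
  triangle_map (a := f) (a' := wf) (b := dg_id Z) (q := 0) (p := pf) TE TD;
  try dg.
(* Here [j] kills [u \oc u1], then [c] kills [u1 \oc g2 \oc wf1], and [eu] compares the two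
   resulting homotopies with [lF]. *)
have [|||||||j [s2 [t2 [[hhu hs2 ht2] dhu ds2 dt2]]]] := PF E (-1) (- (u \oc u1))
  (hg - s \oc u1 - g \oc s1) (- t1 - t \oc u1); try dg.
have [|||||||c [s3 [t3 [[hc hs3 ht3] dc ds3 dt3]]]] :=
  PD OF (-1) (- (u1 \oc (g2 \oc wf1))) (hg1 \oc wf1 - s1 \oc (g2 \oc wf1))
     (- (f \oc eg \oc wf1) + hf \oc lF - f \oc pf1 - t1 \oc (g2 \oc wf1)); try dg.
have [|||||||eu [s4 [t4 [[heu hs4 ht4] deu ds4 dt4]]]] :=
  PF OF (-2) (u \oc c - j \oc (g2 \oc wf1) - lF)
    (s \oc c + g \oc s3 - s2 \oc (g2 \oc wf1) + eg \oc wf1 + pf1)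
    (t \oc c + t3 - t2 \oc (g2 \oc wf1)); try dg.
exists u, u1, j, c, eu, s, s1, w, w1.
split; try (split; dg).
split; try (split; dg); try dg.
split; try dg.
move=> W i x m n i0 hx hm hn dx dm dn.
(* The kernel condition for (u1, u): bound [x] in E, then the discrepancy in D one degree lower, and
   the remaining one in F two degrees lower. *)
have [|||||r [P [Q [[hr hP hQ] dr dP dQ]]]] :=
  PE W i x (v1 \oc m - s1 \oc x) (s \oc m + f1 \oc n + s2 \oc x) i0 hx; try dg.
have [|||||||s' [P2 [Q2 [[hs' hP2 hQ2] ds' dP2 dQ2]]]] :=
  PD W (i - 1) (u1 \oc r - m) (s1 \oc r + P)
    (f \oc Q + hf \oc n + t1 \oc r + t \oc m + t2 \oc x); try dg.
have [|||||||t' [P3 [Q3 [[ht' hP3 hQ3] dt' dP3 dQ3]]]] :=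
  PF W (i - 2) (n - u \oc s' - j \oc r) (Q - s \oc s' - g \oc P2 - s2 \oc r)
    (- (Q2 + t \oc s' + t2 \oc r)); try dg.
exists r, s', t'; split; [split|..]; dg.
Qed.

End Triangles.

(** * Invariance of triangles under homotopy equivalence *)

Section Equivalences.
Context {k : comPzRingType} (A : dgCat k).
Implicit Types X Y Z W : A.

Definition homotopy_equivalence X Y (b : A(X, Y)) (b' : A(Y, X)) : Prop :=
  [/\ is_closed 0 b, is_closed 0 b',
      exists2 p : A(X, X), homog (-1) p & dif p = b' \oc b - dg_id X
    & exists2 q : A(Y, Y), homog (-1) q & dif q = b \oc b' - dg_id Y].

(** The cone of composition with a homotopy equivalence is acyclic in every degree; this moves test
    data for kernels across equivalences. *)
Lemma homotopy_equivalence_lift X Y (b : A(X, Y)) b' W i (x : A(W, X)) m :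
  homotopy_equivalence b b' -> homog (i + 1) x -> homog i m -> dif x = 0 ->
  dif m = b \oc x ->
  exists r s, [/\ homog i r, homog (i - 1) s, dif r = x & dif s = b \oc r - m].
Proof.
move=> [cb cb' [p hp dp] [q hq dq]] hx hm dx dm.
(* Correcting [p] by the closed [b' z] makes (b, b') a coherent equivalence. *)
pose z := q \oc b - b \oc p.
exists (b' \oc m - (p + b' \oc z) \oc x); exists (q \oc m - q \oc (z \oc x)).
rewrite {}/z; split; dg.
Qed.

Lemma triangle_iso_fiber O A2 A1 A0 (l : A(O, A0)) f2 (f1 : A(A2, A1))
    (f0 : A(A1, A0)) h h1 e X (c : A(A2, X)) c' :
  is_triangle l f2 f1 f0 h h1 e -> is_loop l -> homotopy_equivalence c c' ->
  exists (g : A(X, A0)) g1 e', is_triangle l (c \oc f2) (f1 \oc c') f0 g g1 e'.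
Proof.
move=> [[cf1 cf0 hh dh kP] cf2 [hh1 dh1] [he de]] [hl dl _].
case=> cc cc' [p hp dp] [q hq dq].
have E : homotopy_equivalence c' c by split=> //; [exists q | exists p].
exists (h \oc c'), (h1 - f1 \oc p \oc f2), (e + h \oc p \oc f2).
split; [split; try dg | dg | split; dg | split; dg].
move=> W i x m n i0 hx hm hn dx dm dn.
have [||||||r [s [t [[hr hs ht] dr ds dt]]]] := kP W i (c' \oc x) m n i0; try dg.
have [||||R [S [hR hS dR dS]]] :=
  homotopy_equivalence_lift (i := i) (x := x) (m := r) E; try dg.
by exists R, (s + f1 \oc S), (t + h \oc S); split; [split|..]; dg.
Qed.

Lemma triangle_iso_base O A2 A1 A0 (l : A(O, A0)) f2 (f1 : A(A2, A1))
    (f0 : A(A1, A0)) h h1 e B1 B0 (b : A(A1, B1)) b' (a : A(A0, B0)) a'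
    O' (l' : A(O', B0)) w p :
  is_triangle l f2 f1 f0 h h1 e -> is_loop l -> is_loop l' ->
  homotopy_equivalence b b' -> homotopy_equivalence a a' ->
  is_closed 0 w -> homog (-2) p -> dif p = l \oc w - a' \oc l' ->
  exists (g : A(A2, B0)) g1 e',
    is_triangle l' (f2 \oc w) (b \oc f1) (a \oc f0 \oc b') g g1 e'.
Proof.
move=> [[cf1 cf0 hh dh kP] cf2 [hh1 dh1] [he de]] [hl dl _] [hl' dl' _] Eb Ea.
case: (Eb) (Ea) => cb cb' [mu hmu dmu] [nu hnu dnu].
case=> ca ca' [mu' hmu' dmu'] [nu' hnu' dnu'] cw hp dp.
(* The terms in [mu] compensate for [b' \oc b] being the identity only up to homotopy. *)
exists (a \oc h - a \oc f0 \oc mu \oc f1), (b \oc h1 \oc w).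
exists (a \oc e \oc w + a \oc f0 \oc mu \oc h1 \oc w + a \oc p + nu' \oc l').
split; [split; try dg | dg | split; dg | split; dg].
move=> W i x m n i0 hx hm hn dx dm dn.
have [||||M [S [hM hS dM dS]]] :=
  homotopy_equivalence_lift (i := i) (x := f1 \oc x) (m := m) Eb; try dg.
have [||||N [T [hN hT dN dT]]] := homotopy_equivalence_lift (i := i - 1)
  (x := - (f0 \oc M) - h \oc x)
  (m := n + a \oc f0 \oc mu \oc M - a \oc f0 \oc b' \oc S) Ea; try dg.
have [||||||r [s [t [[hr hs ht] dr ds dt]]]] := kP W i x M N i0; try dg.
exists r, (b \oc s + S), (a \oc t - T - a \oc f0 \oc mu \oc s).
split; [split|..]; dg.
Qed.

End Equivalences.

(** * The opposite DG-category *)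

Section Parity.
Context {k : comPzRingType} (M : dgModule k).
Implicit Types u v : M.

Lemma gpart_inj u v : (forall j, gpart j u = gpart j v) -> u = v.
Proof.
move=> uv; have [s Us us] := gpart_sum u; have [t Ut vt] := gpart_sum v.
have Ur := undup_uniq (s ++ t).
have sr : {subset s <= undup (s ++ t)}.
  by move=> i; rewrite mem_undup mem_cat => ->.
have tr : {subset t <= undup (s ++ t)}.
  by move=> i it; rewrite mem_undup mem_cat it orbT.
apply: (etrans (gpart_sum_incl Us Ur sr us)).
apply: (etrans _ (esym (gpart_sum_incl Ut Ur tr vt))).
by apply: eq_bigr => i _; exact: uv.
Qed.

(** The grading involution, equal to (-1)^i in degree i. A finite support is chosen, and
    [gpart_parity] shows that the result does not depend on it. *)
Definition parity u : M :=
  \sum_(i <- s2val (cid2 (gpart_sum u))) sgn i *: gpart i u.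

Lemma gpart_parity j u : gpart j (parity u) = sgn j *: gpart j u.
Proof.
rewrite /parity; case: cid2 => s /= Us us.
rewrite raddf_sum {2}us raddf_sum scaler_sumr; apply: eq_bigr => i _.
by rewrite /= linearZ /= gpart_gpart; case: eqP => [->|] //; rewrite !scaler0.
Qed.

Lemma parity_linear : linear parity.
Proof.
move=> a u v; apply: gpart_inj => j.
rewrite gpart_parity !(gpart_linear (d := M)) !gpart_parity.
by rewrite scalerDr !scalerA mulrC.
Qed.

Lemma parity_homog i u : homog i u -> parity u = sgn i *: u.
Proof.
move=> hu; apply: gpart_inj => j; rewrite gpart_parity linearZ /= -hu gpart_gpart.
by case: eqP => [->|]; rewrite ?scaler0.
Qed.

Lemma gpart_dif j u : gpart j (dif u) = dif (gpart (j - 1) u).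
Proof.
have [s _ ->] := gpart_sum u; rewrite !raddf_sum /=; apply: eq_bigr => i _.
have <- : gpart (i + 1) (dif (gpart i u)) = dif (gpart i u).
  by apply: dif_degree; rewrite gpart_gpart eqxx.
rewrite !gpart_gpart subr_eq; case: eqP => _; last by rewrite raddf0.
by rewrite dif_degree // gpart_gpart eqxx.
Qed.

Lemma parity_dif u : parity (dif u) = - dif (parity u).
Proof.
apply: gpart_inj => j; rewrite gpart_parity raddfN /= !gpart_dif gpart_parity.
by rewrite linearZ /= -[in LHS](sgn_pred j) scaleNr.
Qed.

End Parity.

Section OppositeModule.
Context {k : comPzRingType} (M : dgModule k).

(* Twisting the differential instead of the composition by the parity signs   *)
(* leaves the composites of the opposite category free of signs.              *)
Definition op_dif (u : M) : M := dif (parity u).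

Lemma op_difE i (u : M) : homog i u -> op_dif u = sgn i *: dif u.
Proof. by move=> hu; rewrite /op_dif (parity_homog hu) linearZ. Qed.

Fact op_dif_linear : linear op_dif.
Proof. by move=> a u v; rewrite /op_dif parity_linear linearP. Qed.

Fact op_dif_degree i u : gpart i u = u -> gpart (i + 1) (op_dif u) = op_dif u.
Proof. by move=> hu; rewrite (op_difE hu) linearZ /= dif_degree. Qed.

Fact op_dif_dif u : op_dif (op_dif u) = 0.
Proof. by rewrite /op_dif parity_dif raddfN /= dif_dif oppr0. Qed.

Definition op_module : dgModule k :=
  DgModule (@gpart_linear k M) (@gpart_gpart k M) (@gpart_sum k M)
    op_dif_linear op_dif_degree op_dif_dif.

Lemma op_difP i (u : M) v : homog i u ->
  @dif k op_module u = v <-> dif u = sgn i *: v.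
Proof.
move=> hu; have -> : @dif k op_module u = sgn i *: dif u := op_difE hu.
by split=> [<-|->]; rewrite scale_sgnn.
Qed.

Lemma op_closed0 (u : M) : @is_closed k op_module 0 u <-> is_closed 0 u.
Proof.
split=> -[hu du]; split=> //; first by move/(op_difP _ hu): du; rewrite scaler0.
by apply/(op_difP _ hu); rewrite scaler0.
Qed.

End OppositeModule.
Arguments op_difP {k} M {i u} v _.

Section OppositeCategory.
Context {k : comPzRingType} (A : dgCat k).

Fact op_leibniz X Y Z i (g : dg_hom Z Y) (f : dg_hom (d := A) Y X) :
  homog i g ->
  op_dif (f \oc g) = f \oc op_dif g + sgn i *: (op_dif f \oc g).
Proof.
(* Only [g] is homogeneous, while the Leibniz rule of A needs the degree of [f]: hence the reduction
   to its components. *)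
move=> hg; have [s _ ->] := gpart_sum f.
rewrite (Defs.linear_sum (dg_comp_linearl g)).
rewrite (Defs.linear_sum (dg_comp_linearl (op_dif g))).
rewrite !(Defs.linear_sum (@op_dif_linear _ _)).
rewrite (Defs.linear_sum (dg_comp_linearl g)) scaler_sumr -big_split.
apply: eq_bigr => j _; set fj := gpart j f.
have hf : homog j fj by rewrite /homog gpart_gpart eqxx.
rewrite (op_difE hf) (op_difE hg) (op_difE (dg_comp_homog hf hg)).
rewrite (dg_leibniz _ hf).
rewrite ocZl ocZr -/(sgn j) scalerDr !scalerA sgnD addrC mulrAC sgnn mul1r.
by rewrite [sgn j * _]mulrC.
Qed.

Definition op_cat : dgCat k :=
  @DgCat k A (fun X Y => op_module (dg_hom Y X)) (@dg_id k A)
    (fun X Y Z g f => (f : dg_hom (d := A) Y X) \oc g)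
    (fun X Y Z f => dg_comp_linearr f) (fun X Y Z g => dg_comp_linearl g)
    (fun X Y Z W h g f => esym (dg_compA f g h))
    (fun X Y f => dg_comp1r f) (fun X Y f => dg_comp1l f)
    (@dg_id_homog k A)
    (fun X Y Z i j g f hg hf =>
      eq_ind _ (fun n => homog n _) (dg_comp_homog hf hg) _ (addrC j i))
    op_leibniz.
End OppositeCategory.

(** * Exactness and cohomology *)

(* The elementwise form of: [phi] induces an isomorphism [H^i(M) -> H^j(N)].  *)
Definition cocycle_iso {k : comPzRingType} (M N : dgModule k) (i j : int)
    (phi : M -> N) : Prop :=
  (forall v, is_closed j v ->
     exists u w, [/\ is_closed i u, homog (j - 1) w & dif w = phi u - v]) /\
  (forall u w, is_closed i u -> homog (j - 1) w -> dif w = phi u ->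
     exists2 w', homog (i - 1) w' & dif w' = u).

Section InducesIso.
Context {k : comPzRingType} (M N : dgModule k) (i j : int) (phi : M -> N).
Hypothesis phiB : forall u v, phi (u - v) = phi u - phi v.
Hypothesis phi_closed : forall u, is_closed i u -> is_closed j (phi u).
Hypothesis phi_exact : forall u, homog (i - 1) u ->
  exists2 w, homog (j - 1) w & dif w = phi (dif u).

(** The hypotheses on [phi] are those of a chain map up to sign: loop maps anticommute with the
    differential, and the comparison map of a cokernel carries the sign of one fixed degree. *)
Lemma induces_isoP : induces_iso i j phi <-> cocycle_iso i j phi.
Proof.
have phi0 : phi 0 = 0 by rewrite -[X in phi X](subrr 0) phiB subrr.
split=> [[F Fbij FE]|[phi_surj phi_inj]].
  split=> [v [hv dv]|u w [hu du] hw dw].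
    have [G _ GK] := Fbij; have [u uE] := cls_surj (G (cls (mkCocycle hv dv))).
    have [v' v'E] := FE u; rewrite -uE GK => /esym/clsE[w hw dw].
    by exists u, w; split=> //; [exact: closed_cocycle | rewrite dw v'E].
  (* As [induces_iso] does not ask [F] to be additive, the class of [u] is compared with that of 0
     through injectivity of [F]. *)
  have [v vE Fv] := FE (mkCocycle hu du); have [v0 v0E Fv0] := FE 0.
  have /(bij_inj Fbij)/clsE[w' hw' dw'] : F (cls (mkCocycle hu du)) = F (cls 0).
    by rewrite Fv Fv0; apply/clsE; exists w => //; rewrite vE v0E dw phi0 subr0.
  by exists w' => //; rewrite dw' subr0.
pose psi (u : cocycle M i) : cocycle N j :=
  let: conj hu du := phi_closed (closed_cocycle u) in mkCocycle hu du.
have psiE u : (psi u : N) = phi u by rewrite /psi; case: phi_closed.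
have psi_cls u v : cls (psi u) = cls (psi v) <-> cls u = cls v.
  split=> /clsE[w hw dw]; apply/clsE.
    have [||w' hw' dw'] := phi_inj ((u : M) - (v : M)) w _ hw.
    - have [[hu du] [hv dv]] := (closed_cocycle u, closed_cocycle v).
      by split; [exact: homogB | rewrite raddfB /= du dv subrr].
    - by rewrite dw !psiE phiB.
    by exists w'.
  have [w' hw' dw'] := phi_exact hw.
  by exists w'; rewrite // dw' dw !psiE phiB.
have psi_surj y : exists u, cls (psi u) = y.
  have [v ->] := cls_surj y.
  have [u [w [[hu du] hw dw]]] := phi_surj _ (closed_cocycle v).
  by exists (mkCocycle hu du); apply/clsE; exists w; rewrite // psiE.
pose F (x : cohom M i) : cohom N j := cls (psi (repr x)).
have FE u : F (cls u) = cls (psi u) by apply/psi_cls; rewrite /cls reprK.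
exists F; last by move=> u; exists (psi u).
exists (fun y => cls (sval (cid (psi_surj y)))) => [x|y].
  have [u ->] := cls_surj x; rewrite FE; apply/psi_cls.
  by case: cid.
by rewrite FE; case: cid.
Qed.

End InducesIso.

Section Kernels.
Context {k : comPzRingType} (A : dgCat k) (A_nonpositive : nonpositive A).
Implicit Types X Y Z W : A.

Lemma fib_homogP (M N : dgModule k) (phi : chainMap M N) i m n :
  homog i ((m, n) : fib phi) <-> homog i m /\ homog (i - 1) n.
Proof.
split=> [[em en]|[em en]]; first by split.
by rewrite /homog /= /fib_part /= em en.
Qed.

Lemma fib_difP (M N : dgModule k) (phi : chainMap M N) m n m' n' :
  dif ((m, n) : fib phi) = (m', n') <-> dif m = m' /\ - phi m - dif n = n'.
Proof. by split=> [[em en]|[<- <-]]. Qed.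

(** Acyclicity of the cone in degree i amounts to surjectivity on H^i together with injectivity on
    H^(i+1). *)
Lemma left_exactP X Y Z (f : Z0 X Y) (g : Z0 Y Z) (h : A(X, Z)) :
  left_exact f g h <-> is_kernel (f : A(X, Y)) (g : A(Y, Z)) h.
Proof.
have [cf cg] := (closed_cocycle f, closed_cocycle g).
set f' := (f : A(X, Y)) in cf *; set g' := (g : A(Y, Z)) in cg *.
pose phi W (u : A(W, X)) : fib (postcomp W g) := (f' \oc u, h \oc u).
have isoP W i : homotopy_complex f g h ->
    induces_iso i i (@phi W) <-> cocycle_iso i i (@phi W).
  move=> [hh dh]; rewrite -/f' -/g' in dh; apply: induces_isoP => /=.
  - by move=> u v; congr (_, _); rewrite ocBr.
  - move=> u cu; split; [apply/fib_homogP; split; dg|].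
    by apply/fib_difP; rewrite /= -/g'; split; dg.
  move=> u hu; exists (f' \oc u, h \oc u); first by apply/fib_homogP; split; dg.
  by apply/fib_difP; rewrite /= -/g'; split; dg.
split.
  move=> [cx ex]; case: (cx) => hh dh; rewrite -/f' -/g' in dh.
  split=> // W i u m n i0 hu hm hn du dm dn.
  have [y hy dy] : exists2 y, homog i y & dif y = u.
    (* For i = 0 the element [u] has degree 1 and vanishes by non-positivity. *)
    have [i1|i1] := lerP (i + 1) 0; last first.
      have -> := A_nonpositive i1 hu.
      by exists 0; [exact: homog0 | exact: dif0].
    have [_ inj] := (isoP W _ cx).1 (ex W _ i1).
    have [|||y hy dy] := inj u (m, n); try dg.
    - by apply/fib_homogP; split; dg.
    - by apply/fib_difP; rewrite /= -/g'; split; dg.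
    by exists y => //; rewrite -(addrK 1 i).
  (* The defect of [y] is a cocycle of the fibre. Subtracting from [y] a closed lift [u'] of its
     class leaves [dif y = u] intact. *)
  have [sur _] := (isoP W _ cx).1 (ex W _ i0).
  have [|u' [[s t] [cu' /fib_homogP[hs ht]]]] := sur (f' \oc y - m, h \oc y - n).
    split; [apply/fib_homogP; split; dg|].
    by apply/fib_difP; rewrite /= -/g'; split; dg.
  move/fib_difP => /= -[ds]; rewrite -/g' => dt.
  have {}dt : dif t = - (g' \oc s) - (h \oc u' - (h \oc y - n)).
    by rewrite -dt; zmod.
  by exists (y - u'), (- s), (- t); split; [split|..]; dg.
move=> [_ _ hh dh kP]; have cx : homotopy_complex f g h by [].
split=> // W i i0; apply/isoP => //; split.
  move=> [m n] [/fib_homogP[hm hn] /fib_difP[dm]]; rewrite /= -/g' => dn.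
  have {}dn : dif n = - (g' \oc m) by apply/esym/eqP; rewrite -subr_eq0 dn.
  have [||||||u [s [t [[hu hs ht] du ds dt]]]] := kP W i 0 m n i0; try dg.
  exists u, (s, t); split; [by split | by apply/fib_homogP; split; dg |].
  by apply/fib_difP; rewrite /= -/g'; split; dg.
move=> u [s t] cu /fib_homogP[hs ht] /fib_difP[ds]; rewrite /= -/g' => dt.
have {}dt : dif t = - (g' \oc s) - h \oc u by rewrite -dt; zmod.
have [|||||||w [_ [_ [[hw _ _] dw _ _]]]] := kP W (i - 1) u s t; try dg.
by exists w.
Qed.

(* [is_kernel] of (g, f, -h) in the opposite category, see [op_kernelP]. *)
Definition is_cokernel X Y Z (f : A(X, Y)) (g : A(Y, Z)) (h : A(X, Z)) : Prop :=
  [/\ is_closed 0 f, is_closed 0 g, homog (-1) h, dif h = - (g \oc f) &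
    forall W i (u : A(Z, W)) (m : A(Y, W)) (n : A(X, W)), i <= 0 ->
      homog (i + 1) u -> homog i m -> homog (i - 1) n -> dif u = 0 ->
      dif m = sgn i *: (u \oc g) -> dif n = sgn i *: (m \oc f - u \oc h) ->
      exists r s t, [/\ [/\ homog i r, homog (i - 1) s & homog (i - 2) t],
        dif r = sgn i *: u, dif s = sgn i *: (m - r \oc g)
        & dif t = sgn i *: (n - s \oc f + r \oc h)]].

(** This is [is_loop] of [- l] in the opposite category, unfolded; see [op_loopP]. *)
Definition is_suspension X S (l : A(X, S)) : Prop :=
  [/\ homog (-1) l, dif l = 0 &
    forall W i (u : A(S, W)) (m : A(X, W)), i <= 0 ->
      homog (i + 1) u -> homog (i - 1) m -> dif u = 0 ->
      dif m = - sgn i *: (u \oc l) ->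
      exists r t, [/\ homog i r, homog (i - 2) t, dif r = sgn i *: u
        & dif t = - sgn i *: (r \oc l + m)]].

Lemma right_exactP X Y Z (f : Z0 X Y) (g : Z0 Y Z) (h : A(X, Z)) :
  right_exact f g h <-> is_cokernel (f : A(X, Y)) (g : A(Y, Z)) h.
Proof.
have [cf cg] := (closed_cocycle f, closed_cocycle g).
set f' := (f : A(X, Y)) in cf *; set g' := (g : A(Y, Z)) in cg *.
pose phi i W (u : A(Z, W)) : fib (precomp W f) := (u \oc g', sgn i *: (u \oc h)).
have isoP W i : homotopy_complex f g h ->
    induces_iso i i (@phi i W) <-> cocycle_iso i i (@phi i W).
  move=> [hh dh]; rewrite -/f' -/g' in dh; apply: induces_isoP => /=.
  - by move=> u v; congr (_, _); rewrite ocBl // scalerBr.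
  - move=> u [hu du]; split; [apply/fib_homogP; split; dg|].
    by apply/fib_difP; rewrite /= -/f'; split; dg.
  (* Here [u] has degree i - 1, so its own sign is [- sgn i]. *)
  move=> u hu; exists (u \oc g', - sgn i *: (u \oc h)).
    by apply/fib_homogP; split; dg.
  by apply/fib_difP; rewrite /= -/f'; split; dg.
split.
  move=> [cx ex]; case: (cx) => hh dh; rewrite -/f' -/g' in dh.
  split=> // W i u m n i0 hu hm hn du dm dn.
  have [y hy dy] : exists2 y, homog i y & dif y = sgn i *: u.
    have [i1|i1] := lerP (i + 1) 0; last first.
      have -> := A_nonpositive i1 hu.
      by exists 0; [exact: homog0 | rewrite dif0 scaler0].
    have [_ inj] := (isoP W _ cx).1 (ex W _ i1).
    have [|||y hy dy] := inj (sgn i *: u) (m, - (sgn i *: n)); try dg.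
    - by apply/fib_homogP; split; dg.
    - by apply/fib_difP; rewrite /= -/f'; split; dg.
    by exists y => //; rewrite -(addrK 1 i).
  have [sur _] := (isoP W _ cx).1 (ex W _ i0).
  have [|u' [[s t] [cu' /fib_homogP[hs ht]]]] :=
    sur (y \oc g' - m, sgn i *: (y \oc h + n)).
    split; [apply/fib_homogP; split; dg|].
    by apply/fib_difP; rewrite /= -/f'; split; dg.
  move/fib_difP => /= -[ds]; rewrite -/f' => dt.
  have {}dt : dif t =
      - (s \oc f') - (sgn i *: (u' \oc h) - sgn i *: (y \oc h + n)).
    by rewrite -dt; zmod.
  by exists (y - u'), (sgn i *: s), t; split; [split|..]; dg.
move=> [_ _ hh dh kP]; have cx : homotopy_complex f g h by [].
split=> // W i i0; apply/isoP => //; split.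
  move=> [m n] [/fib_homogP[hm hn] /fib_difP[dm]]; rewrite /= -/f' => dn.
  have {}dn : dif n = - (m \oc f') by apply/esym/eqP; rewrite -subr_eq0 dn.
  have [||||||u [s [t [[hu hs ht] du ds dt]]]] := kP W i 0 m (- (sgn i *: n)) i0;
    try dg.
  rewrite scaler0 in du; exists u, (- (sgn i *: s), - t).
  split; [by split | by apply/fib_homogP; split; dg |].
  by apply/fib_difP; rewrite /= -/f'; split; dg.
move=> u [s t] cu /fib_homogP[hs ht] /fib_difP[ds]; rewrite /= -/f' => dt.
have {}dt : dif t = - (s \oc f') - sgn i *: (u \oc h) by rewrite -dt; zmod.
have [|||||||w [_ [_ [[hw _ _] dw _ _]]]] :=
  kP W (i - 1) (- (sgn i *: u)) s (sgn i *: t); try dg.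
by exists w; rewrite // dw; dg.
Qed.

End Kernels.

(** * Loops, suspensions and their duality *)

Section Loops.
Context {k : comPzRingType} (A : dgCat k) (A_nonpositive : nonpositive A).
Implicit Types X Y Z W : A.

Lemma loop_isoP X O (l : A(O, X)) W i : homog (-1) l -> dif l = 0 ->
  @induces_iso k A(W, O) A(W, X) i (i - 1) (fun u => l \oc u) <->
  @cocycle_iso k A(W, O) A(W, X) i (i - 1) (fun u => l \oc u).
Proof.
move=> hl dl; apply: induces_isoP.
- by move=> u v; rewrite ocBr.
- by move=> u cu; dg.
by move=> u hu; exists (- (l \oc u)); dg.
Qed.

Lemma is_loop_of X (L : loop X) : is_loop (loop_map L).
Proof.
have [hl dl] := (loop_homog L, loop_closed L); set l := loop_map L in hl dl *.
split=> // W i u m i0 hu hm du dm.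
have [y hy dy] : exists2 y, homog i y & dif y = u.
  have [i1|i1] := lerP (i + 1) 0; last first.
    by rewrite (A_nonpositive i1 hu); exists 0; [exact: homog0 | exact: dif0].
  have [_ inj] := (loop_isoP _ _ hl dl).1 (loop_iso L W i1).
  have [|||y hy dy] := inj u (- m); try dg.
  by exists y => //; rewrite -(addrK 1 i).
have [sur _] := (loop_isoP _ _ hl dl).1 (loop_iso L W i0).
have [|u' [w [cu' hw dw]]] := sur (l \oc y - m); first by dg.
by exists (y - u'), (- w); split; dg.
Qed.

Lemma loop_of_is_loop X O (l : A(O, X)) : is_loop l -> inhabited (loop X).
Proof.
move=> [hl dl lP]; constructor; refine (Loop hl dl _) => W i i0.
apply/(loop_isoP _ _ hl dl); split.
  move=> v [hv dv].
  have [||||u [w [hu hw du dw]]] := lP W i 0 v i0; try dg.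
  by exists u, w; split=> //; dg.
move=> u w cu hw dw.
have [|||||r [_ [hr _ dr _]]] := lP W (i - 1) u (- w); try dg.
by exists r.
Qed.

Lemma suspension_isoP X S (l : A(X, S)) W i : homog (-1) l -> dif l = 0 ->
  @induces_iso k A(S, W) A(X, W) i (i - 1) (fun u => u \oc l) <->
  @cocycle_iso k A(S, W) A(X, W) i (i - 1) (fun u => u \oc l).
Proof.
move=> hl dl; apply: induces_isoP.
- by move=> u v; rewrite ocBl.
- by move=> u cu; dg.
by move=> u hu; exists (u \oc l); dg.
Qed.

Lemma is_suspension_of X (S : suspension X) : is_suspension (susp_map S).
Proof.
have [hl dl] := (susp_homog S, susp_closed S); set l := susp_map S in hl dl *.
split=> // W i u m i0 hu hm du dm.
have [y hy dy] : exists2 y, homog i y & dif y = sgn i *: u.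
  have [i1|i1] := lerP (i + 1) 0; last first.
    rewrite (A_nonpositive i1 hu); exists 0; first exact: homog0.
    by rewrite dif0 scaler0.
  have [_ inj] := (suspension_isoP _ _ hl dl).1 (susp_iso S W i1).
  have [|||y hy dy] := inj (sgn i *: u) (- m); try dg.
  by exists y => //; rewrite -(addrK 1 i).
have [sur _] := (suspension_isoP _ _ hl dl).1 (susp_iso S W i0).
have [|u' [w [cu' hw dw]]] := sur (y \oc l + m); first by dg.
by exists (y - u'), (sgn i *: w); split; dg.
Qed.

Lemma suspension_of_is_suspension X S (l : A(X, S)) :
  is_suspension l -> inhabited (suspension X).
Proof.
move=> [hl dl lP]; constructor; refine (Suspension hl dl _) => W i i0.
apply/(suspension_isoP _ _ hl dl); split.
  move=> v [hv dv].
  have [||||u [w [hu hw du dw]]] := lP W i 0 (- v) i0; try dg.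
  rewrite scaler0 in du.
  by exists u, (- (sgn i *: w)); split; [split | dg | dg].
move=> u w [hu du] hw dw.
have [|||||r [_ [hr _ dr _]]] := lP W (i - 1) (- (sgn i *: u)) (- w); try dg.
by exists r; rewrite // dr; dg.
Qed.

(** The loop object is the homotopy kernel of 0 : Z -> X with Z contractible; the contraction [e]
    supplies the middle component of any test cocycle. *)
Lemma loop_exists X Z (e : A(Z, Z)) : homog (-1) e -> dif e = dg_id Z ->
  (forall Y Z (g : A(Y, Z)), is_closed 0 g ->
     exists X (f : A(X, Y)) h, is_kernel f g h) ->
  exists O (l : A(O, X)), is_loop l.
Proof.
move=> he de kerP.
have [|O [f [l [cf cg hl dl lP]]]] := kerP Z X 0; first by dg.
exists O, l; split=> // [|W i u m i0 hu hm du dm]; first by rewrite dl; dg.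
have [||||||r [s [t [[hr _ ht] dr _ dt]]]] :=
  lP W i u (e \oc (f \oc u)) m i0; try dg.
by exists r, (- t); split; dg.
Qed.

Lemma op_ocN X Y Z (h : A(X, Y)) (u : A(Y, Z)) :
  @dg_comp k (op_cat A) Z Y X (- h) u = - (u \oc h) :> A(X, Z).
Proof. exact: (ocNr u h). Qed.

(** The opposite differential is [- dif] in degree -1, which forces the sign of [h]. *)
Lemma op_kernelP X Y Z (f : A(X, Y)) (g : A(Y, Z)) (h : A(X, Z)) :
  @is_kernel k (op_cat A) Z Y X g f (- h) <-> is_cokernel f g h.
Proof.
split=> -[].
  move=> /op_closed0 cg /op_closed0 cf /homogN; rewrite opprK => hh.
  move=> /(op_difP A(X, Z) _ (homogN hh)) dh kP; split=> //.
    by rewrite -[h]opprK difN dh scaleN1r opprK.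
  move=> W i u m n i0 hu hm hn du dm dn.
  have [|||r [s [t [[hr hs ht] dr ds dt]]]] := kP W i u m n i0 hu hm hn.
  - by apply/(op_difP A(Z, W) _ hu); rewrite scaler0.
  - by apply/(op_difP A(Y, W) _ hm).
  - apply/(op_difP A(X, W) _ hn); rewrite dn sgnB1 scaleNr -scalerN.
    congr (_ *: _); by rewrite opprB op_ocN opprK addrC.
  exists r, s, t; split=> //.
  - exact/(op_difP A(Z, W) _ hr).
  - move/(op_difP A(Y, W) _ hs): ds => ->.
    by rewrite sgnB1 scaleNr -scalerN opprB.
  move/(op_difP A(X, W) _ ht): dt => ->; rewrite sgnB2; congr (_ *: _).
  by rewrite op_ocN opprK.
move=> cf cg hh dh kP; split; try exact/op_closed0; first exact: homogN.
  by apply/(op_difP A(X, Z) _ (homogN hh)); rewrite difN dh scaleN1r.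
move=> W i u m n i0 hu hm hn /(op_difP A(Z, W) _ hu) du.
move=> /(op_difP A(Y, W) _ hm) dm /(op_difP A(X, W) _ hn) dn.
have [|||r [s [t [[hr hs ht] dr ds dt]]]] := kP W i u m n i0 hu hm hn.
- by rewrite du scaler0.
- by [].
- rewrite dn sgnB1 scaleNr -scalerN; congr (_ *: _).
  by rewrite op_ocN opprB opprK addrC.
exists r, s, t; split=> //.
- exact/(op_difP A(Z, W) _ hr).
- by apply/(op_difP A(Y, W) _ hs); rewrite ds sgnB1 scaleNr -scalerN opprB.
apply/(op_difP A(X, W) _ ht); rewrite dt sgnB2; congr (_ *: _).
by rewrite op_ocN opprK.
Qed.

(** The sign of [l] is the one that turns the equation for eta in a standard right triangle into
    that of a left triangle of the opposite category. *)
Lemma op_loopP X S (l : A(X, S)) :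
  @is_loop k (op_cat A) X S (- l) <-> is_suspension l.
Proof.
split=> -[].
  move=> /homogN; rewrite opprK => hl /(op_difP A(X, S) _ (homogN hl)) dl lP.
  split=> //.
    by rewrite -[l]opprK difN dl scaler0 oppr0.
  move=> W i u m i0 hu hm du dm.
  have [||r [t [hr ht dr dt]]] := lP W i u m i0 hu hm.
  - by apply/(op_difP A(S, W) _ hu); rewrite scaler0.
  - apply/(op_difP A(X, W) _ hm); rewrite dm sgnB1; congr (_ *: _).
    by rewrite op_ocN opprK.
  exists r, t; split=> //; first exact/(op_difP A(S, W) _ hr).
  move/(op_difP A(X, W) _ ht): dt => ->; rewrite sgnB2 scaleNr -scalerN.
  congr (_ *: _).
  by rewrite op_ocN opprD.
move=> hl dl lP; split; first exact: homogN.
  by apply/(op_difP A(X, S) _ (homogN hl)); rewrite difN dl oppr0 scaler0.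
move=> W i u m i0 hu hm /(op_difP A(S, W) _ hu) du /(op_difP A(X, W) _ hm) dm.
have [||r [t [hr ht dr dt]]] := lP W i u m i0 hu hm.
- by rewrite du scaler0.
- rewrite dm sgnB1; congr (_ *: _).
  by rewrite op_ocN opprK.
exists r, t; split=> //; first exact/(op_difP A(S, W) _ hr).
apply/(op_difP A(X, W) _ ht); rewrite dt sgnB2 scaleNr -scalerN; congr (_ *: _).
by rewrite op_ocN opprD.
Qed.

End Loops.

(** * Left triangulation *)

(* A category presented by the homotopy classes of A need not be H0 A itself:  *)
(* the opposite of H0 A is presented by the opposite DG-category, although its *)
(* morphisms are not the cohomology classes of the latter on the nose.         *)
Record presentation (k : comPzRingType) (A : dgCat k) := Presentation {
  p_mor : A -> A -> zmodType;
  p_id : forall X, p_mor X X;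
  p_comp : forall X Y Z, p_mor Y Z -> p_mor X Y -> p_mor X Z;
  p_compA : forall X Y Z W (h : p_mor Z W) (g : p_mor Y Z) (f : p_mor X Y),
    p_comp h (p_comp g f) = p_comp (p_comp h g) f;
  p_comp1l : forall X Y (f : p_mor X Y), p_comp (p_id Y) f = f;
  p_comp1r : forall X Y (f : p_mor X Y), p_comp f (p_id X) = f;
  p_compDl : forall X Y Z (g g' : p_mor Y Z) (f : p_mor X Y),
    p_comp (g + g') f = p_comp g f + p_comp g' f;
  p_compDr : forall X Y Z (g : p_mor Y Z) (f f' : p_mor X Y),
    p_comp g (f + f') = p_comp g f + p_comp g f';
  p_cls : forall X Y, dg_hom X Y -> p_mor X Y;
  p_cls_surj : forall X Y (f : p_mor X Y), exists2 u, is_closed 0 u & f = p_cls u;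
  p_cls_eq : forall X Y (u v : dg_hom X Y), is_closed 0 u -> is_closed 0 v ->
    p_cls u = p_cls v <-> exists2 w, homog (-1) w & dif w = u - v;
  p_cls_id : forall X, p_cls (dg_id X) = p_id X;
  p_cls_comp : forall X Y Z (g : dg_hom Y Z) (f : dg_hom X Y),
    is_closed 0 g -> is_closed 0 f ->
    p_cls (g \oc f) = p_comp (p_cls g) (p_cls f);
  p_cls_add : forall X Y (u v : dg_hom X Y), is_closed 0 u -> is_closed 0 v ->
    p_cls (u + v) = p_cls u + p_cls v
}.

Definition presented (k : comPzRingType) (A : dgCat k) (P : presentation A) :=
  PreaddCat (@p_compA k A P) (@p_comp1l k A P) (@p_comp1r k A P)
    (@p_compDl k A P) (@p_compDr k A P).

Section Presented.
Context {k : comPzRingType} (A : dgCat k) (P : presentation A).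
Implicit Types X Y Z W : A.
Local Notation C := (presented P).

Definition pcl X Y (u : A(X, Y)) : @mor C X Y := p_cls P u.

Lemma pcl_surj X Y (f : @mor C X Y) :
  exists2 u : A(X, Y), is_closed 0 u & f = pcl u.
Proof. exact: p_cls_surj. Qed.

Lemma pcl_eq X Y (u v : A(X, Y)) : is_closed 0 u -> is_closed 0 v ->
  pcl u = pcl v <-> exists2 w, homog (-1) w & dif w = u - v.
Proof. exact: p_cls_eq. Qed.

Lemma pcl_id X : pcl (dg_id X) = @idm C X. Proof. exact: p_cls_id. Qed.

Lemma pcl_comp X Y Z (g : A(Y, Z)) (f : A(X, Y)) :
  is_closed 0 g -> is_closed 0 f -> pcl (g \oc f) = pcl g \oh pcl f.
Proof. exact: p_cls_comp. Qed.

Lemma pcl_add X Y (u v : A(X, Y)) : is_closed 0 u -> is_closed 0 v ->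
  pcl (u + v) = pcl u + pcl v.
Proof. exact: p_cls_add. Qed.

Lemma pcl0 X Y : pcl (0 : A(X, Y)) = 0.
Proof.
have c0 : is_closed 0 (0 : A(X, Y)) by dg.
by apply: (addrI (pcl 0)); rewrite -pcl_add // !addr0.
Qed.

Lemma pclN X Y (u : A(X, Y)) : is_closed 0 u -> pcl (- u) = - pcl u.
Proof.
move=> cu; have cNu : is_closed 0 (- u) by dg.
by apply/eqP; rewrite -addr_eq0 -pcl_add // addNr pcl0.
Qed.

Lemma zero_object_contraction Z : @zero_object C Z ->
  exists2 e : A(Z, Z), homog (-1) e & dif e = dg_id Z.
Proof.
move=> Z0; have cid : is_closed 0 (dg_id Z) by dg.
have c0 : is_closed 0 (0 : A(Z, Z)) by dg.
have /(pcl_eq cid c0) [e he de] : pcl (dg_id Z) = pcl 0.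
  by rewrite pcl_id pcl0; apply: (Z0 Z).1.
by exists e; rewrite // de subr0.
Qed.

Lemma isomorphism_equivalence X Y (b : A(X, Y)) : is_closed 0 b ->
  @isomorphism C X Y (pcl b) ->
  exists2 b' : A(Y, X), homotopy_equivalence b b' &
    pcl b' \oh pcl b = @idm C X /\ pcl b \oh pcl b' = @idm C Y.
Proof.
move=> cb [g]; have [b' cb' ->] := pcl_surj g => gb bg; exists b' => //.
have cX : is_closed 0 (dg_id X) by dg.
have cY : is_closed 0 (dg_id Y) by dg.
have cbb : is_closed 0 (b' \oc b) by dg.
have cbb' : is_closed 0 (b \oc b') by dg.
split=> //.
  by apply/(pcl_eq cbb cX); rewrite pcl_comp // pcl_id.
by apply/(pcl_eq cbb' cY); rewrite pcl_comp // pcl_id.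
Qed.

Section Loops.
Variables (Om : A -> A) (l : forall X, A(Om X, X)).
Hypothesis lP : forall X, is_loop (l X).

Definition is_loop_functor_of
    (Om1 : forall X Y : C, mor X Y -> @mor C (Om X) (Om Y)) : Prop :=
  forall X Y (f : A(X, Y)) (f' : A(Om X, Om Y)),
    is_closed 0 f -> is_closed 0 f' ->
    Om1 X Y (pcl f) = pcl f' <->
    exists2 t, homog (-2) t & dif t = l Y \oc f' - f \oc l X.

Lemma loop_map_exists X Y (f : A(X, Y)) : is_closed 0 f ->
  exists f', is_closed 0 f' /\
    exists2 t, homog (-2) t & dif t = l Y \oc f' - f \oc l X.
Proof.
move=> cf; have [[hX dX _] [hY dY _]] := (lP X, lP Y).
have [|||f' [t [hf' df' ht dt]]] :=
  loop_lift (i := 0) (v := f \oc l X) (lP Y); try dg.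
by exists f'; split; [split | exists t].
Qed.

(** By [loop_inj] the relation [R] is single-valued on homotopy classes, so any choice of related
    classes satisfies the characterization. *)
Lemma loop_functor_exists : exists Om1, is_loop_functor_of Om1.
Proof.
pose R X Y (f : @mor C X Y) (f' : @mor C (Om X) (Om Y)) :=
  exists (u : A(X, Y)) (v : A(Om X, Om Y)),
    [/\ is_closed 0 u, is_closed 0 v, f = pcl u, f' = pcl v &
    exists2 t, homog (-2) t & dif t = l Y \oc v - u \oc l X].
have exR X Y (f : @mor C X Y) : exists f', R X Y f f'.
  have [u cu ->] := pcl_surj f; have [v [cv tP]] := loop_map_exists cu.
  by exists (pcl v), u, v.
exists (fun X Y f => sval (cid (exR X Y f))) => X Y f f' cf cf'.
case: cid => /= _ [u [v [cu cv /(pcl_eq cf cu)[w hw dw] -> [t ht dt]]]].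
have [[hX dX _] [hY dY _]] := (lP X, lP Y).
split.
  move=> /esym/(pcl_eq cf' cv)[w' hw' dw'].
  by exists (t - l Y \oc w' - w \oc l X); dg.
move=> [t' ht' dt']; apply/(pcl_eq cv cf').
by apply: (loop_inj (lP Y) (t := t - t' - w \oc l X)); dg.
Qed.

Definition triangles : @left_class C Om :=
  fun A0 A2 A1 f2 f1 f0 => exists z2 z1 z0 h h1 e,
    [/\ f2 = pcl z2, f1 = pcl z1, f0 = pcl z0
      & is_triangle (l A0) z2 z1 z0 h h1 e].

Variable Om1 : forall X Y : C, mor X Y -> @mor C (Om X) (Om Y).
Hypothesis Om1P : is_loop_functor_of Om1.

Lemma loop_additive_functor : @additive_functor C Om Om1.
Proof.
split=> [X|X Y Z g f|X Y f g].
- have [hX dX _] := lP X.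
  rewrite -!pcl_id; apply/Om1P; try dg.
  by exists 0; dg.
- have [g0 cg ->] := pcl_surj g; have [f0 cf ->] := pcl_surj f.
  have [g' [cg' [s hs ds]]] := loop_map_exists cg.
  have [f' [cf' [t ht dt]]] := loop_map_exists cf.
  rewrite ((Om1P cg cg').2 _); last by exists s.
  rewrite ((Om1P cf cf').2 _); last by exists t.
  rewrite -!pcl_comp //; apply/Om1P; try dg.
  by exists (s \oc f' + g0 \oc t); dg.
have [f0 cf ->] := pcl_surj f; have [g0 cg ->] := pcl_surj g.
have [f' [cf' [t ht dt]]] := loop_map_exists cf.
have [g' [cg' [s hs ds]]] := loop_map_exists cg.
rewrite ((Om1P cg cg').2 _); last by exists s.
rewrite ((Om1P cf cf').2 _); last by exists t.
rewrite -!pcl_add //; apply/Om1P; try dg.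
by exists (t + s); dg.
Qed.

(** Transport first along the equivalences of the base, then along that of the fibre. The
    transported maps are conjugates by the isomorphisms, hence have the classes [h], [g], [f]. *)
Lemma triangles_iso A0 A2 A1 (h : @mor C (Om A0) A2) (g : @mor C A2 A1)
    (f : @mor C A1 A0) :
  left_iso_closure Om1 triangles A0 A2 A1 h g f -> triangles h g f.
Proof.
move=> [B0 [B2 [B1 [h' [g' [f' [c [b [a []]]]]]]]]].
move=> [z2 [z1 [z0 [k0 [k1 [e [-> -> -> T]]]]]]].
have [c0 cc ->] := pcl_surj c; have [b0 cb ->] := pcl_surj b.
have [a0 ca ->] := pcl_surj a.
move=> /(isomorphism_equivalence cc)[c' Ec [c'c cc']].
move=> /(isomorphism_equivalence cb)[b' Eb [b'b bb']].
move=> /(isomorphism_equivalence ca)[a' Ea [a'a aa']].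
have [_ ca' _ _] := Ea; have [w [cw [p hp dp]]] := loop_map_exists ca'.
have Fa : Om1 (pcl a') = pcl w by apply/Om1P => //; exists p.
case=> hE gE fE.
have [_ cb' _ _] := Eb; have [_ cc0 _ _] := Ec.
have [k0' [k1' [e' T']]] := triangle_iso_base T (lP _) (lP _) Eb Ea cw hp dp.
have [k0'' [k1'' [e'' T'']]] := triangle_iso_fiber T' (lP _) Ec.
exists (c0 \oc (z2 \oc w)), (b0 \oc z1 \oc c'), (a0 \oc z0 \oc b').
exists k0'', k1'', e''.
case: T => [[cz1 cz0 _ _ _] cz2 _ _].
split=> //.
- rewrite !pcl_comp //; try dg.
  rewrite -Fa mcompA hE -mcompA -(functor_comp loop_additive_functor) aa'.
  by rewrite (functor_id loop_additive_functor) mcomp1r.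
- rewrite !pcl_comp //; try dg.
  by rewrite gE -mcompA cc' mcomp1r.
rewrite !pcl_comp //; try dg.
by rewrite fE -mcompA bb' mcomp1r.
Qed.

Hypothesis additiveC : additive_category C.
Hypothesis kerP : forall Y Z (g : A(Y, Z)), is_closed 0 g ->
  exists X (f : A(X, Y)) h, is_kernel f g h.

Theorem triangles_left_triangulated : @left_triangulated C Om Om1 triangles.
Proof.
split=> //.
- exact: loop_additive_functor.
- exact: triangles_iso.
- move=> O X /zero_object_contraction[e he de].
  have [hl dl _] := lP O.
  (* The contraction [e] of the zero object bounds both the loop map and the last component of a
     test cocycle. *)
  exists 0, (dg_id X), 0, 0, 0, (- (e \oc l O)).
  rewrite pcl_id !pcl0; split=> //; split; [split | | split |split]; try dg.
  move=> W i u m n i0 hu hm hn du dm dn.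
  by exists m, 0, (e \oc n); split; [split|..]; dg.
- move=> Y X f; have [z0 cz0 ->] := pcl_surj f.
  have [V [z1 [h Kz]]] := kerP cz0.
  have [z2 [h1 [e T]]] := triangle_exists (lP X) Kz.
  by exists V, (pcl z2), (pcl z1), z2, z1, z0, h, h1, e.
- move=> A0 A2 A1 h g f [z2 [z1 [z0 [k0 [k1 [e [-> -> -> T]]]]]]].
  case: (T) => [[_ cz0 _ _ _] _ _ _].
  have [w [cw [p hp dp]]] := loop_map_exists cz0.
  have [k0' [e' T']] := triangle_rotate T (lP _) (lP _) cw hp dp.
  exists (- w), z2, z1, k1, k0', e'; split=> //.
  by rewrite pclN //; congr (- _); apply/Om1P => //; exists p.
- move=> A0 A2 A1 h g f B0 B2 B1 h' g' f' b a.
  move=> [z2 [z1 [z0 [k0 [k1 [e [-> -> -> T]]]]]]].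
  move=> [y2 [y1 [y0 [j0 [j1 [d [-> -> -> U]]]]]]].
  have [b0 cb ->] := pcl_surj b; have [a0 ca ->] := pcl_surj a.
  case: (T) (U) => [[cz1 cz0 _ _ _] cz2 _ _] [[cy1 cy0 _ _ _] cy2 _ _].
  have [a' [ca' [p hp dp]]] := loop_map_exists ca.
  rewrite -!pcl_comp // => /pcl_eq[||q hq dq]; try dg.
  have [c [s [t [w [cc [hs ds] [ht dt] [hw dw]]]]]] :=
    triangle_map T U ca cb ca' hq dq hp dp.
  exists (pcl c); rewrite /left_morphism.
  have -> : Om1 (pcl a0) = pcl a' by apply/Om1P => //; exists p.
  split; rewrite -!pcl_comp //; apply/pcl_eq; try dg.
  + by exists w.
  + by exists (- s); dg.
  by exists q.
move=> X Y Z E F f2 f1 f g2 g1 g.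
move=> [z2 [z1 [z0 [k0 [k1 [e [-> -> -> TF]]]]]]].
move=> [y2 [y1 [y0 [j0 [j1 [d [-> -> -> TE]]]]]]].
case: (TF) (TE) => [[cz1 cz0 _ _ _] cz2 _ _] [[cy1 cy0 _ _ _] cy2 _ _].
have [|D [v1 [m0 KD]]] := kerP (g := z0 \oc y0); first by dg.
have [v2 [m1 [i TD]]] := triangle_exists (lP X) KD.
have [w [cw [p hp dp]]] := loop_map_exists cz0.
have [w1 [cw1 [p1 hp1 dp1]]] := loop_map_exists cz1.
have [u [u1 [n0 [n1 [eu [s [s1 [t [t1
    [TU [hs ds] [hs1 ds1] [ht dt] [ht1 dt1]]]]]]]]]]] :=
  octahedron TF TE TD (lP _) (lP _) (lP _) cw hp dp cw1 hp1 dp1.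
case: (TD) (TU) => [[cv1 _ _ _ _] cv2 _ _] [[cu1 cu _ _ _] _ _ _].
have -> : Om1 (pcl z1) = pcl w1 by apply/Om1P => //; exists p1.
have -> : Om1 (pcl z0) = pcl w by apply/Om1P => //; exists p.
exists D, (pcl v2), (pcl v1), (pcl (y2 \oc w1)), (pcl u1), (pcl u).
split.
- by exists v2, v1, (z0 \oc y0), m0, m1, i; split=> //; rewrite pcl_comp.
- by exists (y2 \oc w1), u1, u, n0, n1, eu.
split; rewrite -?pcl_comp //; apply/pcl_eq; try dg.
- by exists s1.
- by exists s.
- by exists t.
by exists t1.
Qed.

End Loops.
End Presented.

(** * The homotopy category *)

Section HomotopyClasses.
Context {k : comPzRingType} (A : dgCat k).
Implicit Types X Y Z W : A.

(* Only meaningful on closed morphisms of degree 0; elsewhere it is 0. *)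
Definition hcls X Y (u : A(X, Y)) : @mor (H0 A) X Y :=
  if pselect (is_closed 0 u) is left cu then cls (mkCocycle cu.1 cu.2) else 0.

Lemma hclsE X Y (z : Z0 X Y) : hcls (z : A(X, Y)) = cls z.
Proof.
rewrite /hcls; case: pselect => [cz|]; last by case; exact: closed_cocycle.
by congr cls; apply: val_inj.
Qed.

Lemma hcls_closed X Y (u : A(X, Y)) : is_closed 0 u ->
  exists2 z : Z0 X Y, (z : A(X, Y)) = u & hcls u = cls z.
Proof. by case=> hu du; exists (mkCocycle hu du) => //; rewrite -hclsE. Qed.

Lemma hcls_surj X Y (f : @mor (H0 A) X Y) :
  exists2 u : A(X, Y), is_closed 0 u & f = hcls u.
Proof.
have [z ->] := cls_surj f; exists (z : A(X, Y)); last by rewrite hclsE.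
exact: closed_cocycle.
Qed.

Lemma hcls_eq X Y (u v : A(X, Y)) : is_closed 0 u -> is_closed 0 v ->
  hcls u = hcls v <-> exists2 w, homog (-1) w & dif w = u - v.
Proof. by move=> /hcls_closed[u' <- ->] /hcls_closed[v' <- ->]; exact: clsE. Qed.

Lemma hcls_id X : hcls (dg_id X) = @idm (H0 A) X.
Proof. exact: (hclsE (zid X)). Qed.

Lemma hcls_comp X Y Z (g : A(Y, Z)) (f : A(X, Y)) :
  is_closed 0 g -> is_closed 0 f ->
  hcls (g \oc f) = @mcomp (H0 A) _ _ _ (hcls g) (hcls f).
Proof.
move=> /hcls_closed[g' <- ->] /hcls_closed[f' <- ->].
by rewrite -[RHS]/(hcomp _ _) hcompE -hclsE.
Qed.

Lemma hcls_add X Y (u v : A(X, Y)) : is_closed 0 u -> is_closed 0 v ->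
  hcls (u + v) = hcls u + hcls v.
Proof.
move=> /hcls_closed[u' <- ->] /hcls_closed[v' <- ->].
by rewrite -[RHS]clsD -hclsE.
Qed.

Definition H0_presentation : presentation A :=
  Presentation (@mcompA (H0 A)) (@mcomp1l (H0 A)) (@mcomp1r (H0 A))
    (@mcompDl (H0 A)) (@mcompDr (H0 A))
    hcls_surj hcls_eq hcls_id hcls_comp hcls_add.

Let op_hcls X Y (u : @dg_hom k (op_cat A) X Y) : @mor (opCat (H0 A)) X Y :=
  @hcls Y X u.

Fact op_hcls_surj X Y (f : @mor (opCat (H0 A)) X Y) :
  exists2 u, is_closed 0 u & f = @op_hcls X Y u.
Proof.
by have [u cu ->] := @hcls_surj Y X f; exists u => //; apply/op_closed0.
Qed.

Fact op_hcls_eq X Y (u v : @dg_hom k (op_cat A) X Y) :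
  is_closed 0 u -> is_closed 0 v ->
  op_hcls u = op_hcls v <-> exists2 w, homog (-1) w & dif w = u - v.
Proof.
move=> /(@op_closed0 _ A(Y, X)) cu /(@op_closed0 _ A(Y, X)) cv.
split=> [/(hcls_eq cu cv)[w hw dw]|[w hw /(op_difP A(Y, X) _ hw) dw]].
  exists (- w); first exact: homogN.
  by apply/(op_difP A(Y, X) _ (homogN hw)); rewrite difN dw scaleN1r.
apply/(hcls_eq cu cv); exists (- w); first exact: homogN.
by rewrite difN dw scaleN1r opprK.
Qed.

Fact op_hcls_comp X Y Z (g : @dg_hom k (op_cat A) Y Z)
    (f : @dg_hom k (op_cat A) X Y) :
  is_closed 0 g -> is_closed 0 f ->
  op_hcls (g \oc f) = @mcomp (opCat (H0 A)) _ _ _ (op_hcls g) (op_hcls f).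
Proof.
move=> /(@op_closed0 _ A(Z, Y)) cg /(@op_closed0 _ A(Y, X)) cf.
exact: hcls_comp.
Qed.

Fact op_hcls_add X Y (u v : @dg_hom k (op_cat A) X Y) :
  is_closed 0 u -> is_closed 0 v ->
  op_hcls (u + v) = op_hcls u + op_hcls v.
Proof.
move=> /(@op_closed0 _ A(Y, X)) cu /(@op_closed0 _ A(Y, X)) cv.
exact: hcls_add.
Qed.

(** It presents [opCat (H0 A)] up to conversion, which is the category where [right_triangulated]
    lives. *)
Definition op_presentation : presentation (op_cat A) :=
  @Presentation k (op_cat A) (@mor (opCat (H0 A))) _ _
    (@mcompA (opCat (H0 A))) (@mcomp1l (opCat (H0 A))) (@mcomp1r (opCat (H0 A)))
    (@mcompDl (opCat (H0 A))) (@mcompDr (opCat (H0 A)))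
    op_hcls op_hcls_surj op_hcls_eq hcls_id op_hcls_comp op_hcls_add.

Lemma op_additive : additive_category (H0 A) -> additive_category (opCat (H0 A)).
Proof.
move=> [[O zO] bi]; split.
  by exists O => X; split=> f; [apply: (zO X).2 | apply: (zO X).1].
move=> X Y; have [P [i1 [i2 [p1 [p2 [e1 e2 e3 e4 e5]]]]]] := bi X Y.
by exists P, p1, p2, i1, i2.
Qed.

Section Cokernels.
Variables (X Y Z : A) (f : A(X, Y)) (g : A(Y, Z)) (h : A(X, Z)).
Hypothesis cokP : is_cokernel f g h.

Lemma cokernel_lift W (m : A(Y, W)) (n : A(X, W)) :
  is_closed 0 m -> homog (-1) n -> dif n = - (m \oc f) ->
  exists c s t, [/\ is_closed 0 c, homog (-1) s, homog (-2) t,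
    dif s = c \oc g - m & dif t = c \oc h + s \oc f - n].
Proof.
move=> [hm dm] hn dn; have [cf cg hh dh kP] := cokP.
have [|||||||c [s [t [[hc hs ht] dc ds dt]]]] := kP W 0 0 m (- n); try dg.
rewrite sgn0 !scale1r in dc ds dt.
by exists c, (- s), t; split=> //; dg.
Qed.

Lemma cokernel_inj W (u : A(Z, W)) s (t : A(X, W)) :
  is_closed 0 u -> homog (-1) s -> homog (-2) t ->
  dif s = u \oc g -> dif t = s \oc f + u \oc h ->
  exists2 w, homog (-1) w & dif w = u.
Proof.
move=> [hu du] hs ht ds dt; have [cf cg hh dh kP] := cokP.
have [|||||||c [_ [_ [[hc _ _] dc _ _]]]] := kP W (-1) u (- s) t; try dg.
by exists (- c); dg.
Qed.

End Cokernels.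

Lemma suspension_lift X S (l : A(X, S)) W (v : A(X, W)) :
  is_suspension l -> homog (-1) v -> dif v = 0 ->
  exists u t, [/\ is_closed 0 u, homog (-2) t & dif t = u \oc l - v].
Proof.
move=> [hl dl lP] hv dv.
have [|||||u [t [hu ht du dt]]] := lP W 0 0 (- v); try dg.
rewrite scaler0 in du.
by exists u, (- t); split; dg.
Qed.

Lemma suspension_inj X S (l : A(X, S)) W (u : A(S, W)) t :
  is_suspension l -> is_closed 0 u -> homog (-2) t -> dif t = u \oc l ->
  exists2 w, homog (-1) w & dif w = u.
Proof.
move=> [hl dl lP] [hu du] ht dt.
have [|||||r [_ [hr _ dr _]]] := lP W (-1) u t; try dg.
by exists (- r); dg.
Qed.

(** * Standard triangles of a preabelian DG-category *)

Section Standard.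
Hypothesis A_nonpositive : nonpositive A.

Lemma preabelian_kernel : preabelian A ->
  forall Y Z (g : A(Y, Z)), is_closed 0 g ->
  exists X (f : A(X, Y)) h, is_kernel f g h.
Proof.
move=> [_ ker _] Y Z g /hcls_closed[z <- _].
have [X [f [h /(left_exactP A_nonpositive) kP]]] := ker _ _ z.
by exists X, (f : A(X, Y)), h.
Qed.

Lemma preabelian_cokernel : preabelian A ->
  forall Y Z (g : @dg_hom k (op_cat A) Y Z), is_closed 0 g ->
  exists X (f : @dg_hom k (op_cat A) X Y) h, is_kernel f g h.
Proof.
move=> [_ _ coker] Y Z f /(@op_closed0 _ A(Z, Y))/hcls_closed[z <- _].
have [X [g [h /(right_exactP A_nonpositive) kP]]] := coker _ _ z.
by exists X, (g : A(Y, X)), (- h); apply/op_kernelP.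
Qed.

Lemma preabelian_loop : preabelian A -> forall X, inhabited (loop X).
Proof.
move=> preA X; have [[[Z zZ] _] _ _] := preA.
have [e he de] := @zero_object_contraction k A H0_presentation Z zZ.
have [O [l lP]] := loop_exists X he de (preabelian_kernel preA).
exact: loop_of_is_loop lP.
Qed.

Lemma preabelian_suspension : preabelian A -> forall X, inhabited (suspension X).
Proof.
move=> preA X; have [addA _ _] := preA; have [[Z zZ] _] := op_additive addA.
have [e he de] := @zero_object_contraction k (op_cat A) op_presentation Z zZ.
have [S [l lP]] :=
  @loop_exists k (op_cat A) X Z e he de (preabelian_cokernel preA).
apply: (@suspension_of_is_suspension k A X S (- l)).
by apply/op_loopP; rewrite opprK.
Qed.

Variables (L : forall X, loop X) (S : forall X, suspension X).

Let l X : A(L X, X) := loop_map (L X).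
Let s X : A(X, S X) := susp_map (S X).

Let op_s X : @dg_hom k (op_cat A) (S X) X := - s X.

Let lP X : is_loop (l X) := is_loop_of A_nonpositive (L X).
Let sP X : is_suspension (s X) := is_suspension_of A_nonpositive (S X).
Let op_sP X : is_loop (op_s X).
Proof. exact/op_loopP. Qed.

Lemma standard_leftE A0 A2 A1 f2 f1 f0 :
  @standard_left k A L A0 A2 A1 f2 f1 f0 <->
  triangles (P := H0_presentation) l f2 f1 f0.
Proof.
split.
  move=> [z2 [z1 [z0 [h [h1 [e [[-> -> ->]]]]]]]].
  move=> /(left_exactP A_nonpositive) kP hh1 he.
  exists z2, z1, z0, h, h1, e; split; [exact/esym/hclsE..|].
  by split=> //; exact: closed_cocycle.
move=> [z2 [z1 [z0 [h [h1 [e [-> -> -> [kP cz2 hh1 he]]]]]]]].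
have [cz1 cz0 _ _ _] := kP.
have [y2 y2E e2] := hcls_closed cz2; have [y1 y1E e1] := hcls_closed cz1.
have [y0 y0E e0] := hcls_closed cz0.
exists y2, y1, y0, h, h1, e; rewrite y2E y1E y0E; split=> //.
by apply/(left_exactP A_nonpositive); rewrite y1E y0E.
Qed.

(** Duality negates both homotopies of degree -1 and the suspension map; eta, of even degree, keeps
    its sign. *)
Lemma standard_rightE A0 A1 A2 f0 f1 f2 :
  @standard_right k A S A0 A1 A2 f0 f1 f2 <->
  @triangles k (op_cat A) op_presentation (fun X => S X) op_s A0 A2 A1 f2 f1 f0.
Proof.
split.
  move=> [z0 [z1 [z2 [h [h1 [e [[-> -> ->]]]]]]]].
  move=> /(right_exactP A_nonpositive) kP [hh1 dh1] [he de].
  exists (z2 : A(A2, S A0)), (z1 : A(A1, A2)), (z0 : A(A0, A1)), (- h), (- h1), e.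
  split; [exact/esym/hclsE..|].
  split; [exact/op_kernelP | exact/op_closed0/closed_cocycle | split | split=> //].
  - exact: homogN.
  - by apply/(op_difP A(A1, S A0) _ (homogN hh1)); rewrite difN dh1 scaleN1r.
  apply/(op_difP A(A0, S A0) _ he); rewrite de sgnN2 scale1r /op_s.
  rewrite -[dg_comp (d := op_cat A) _ (- h1)]/(@dg_comp k A _ _ _ (- h1) z0).
  rewrite -[dg_comp (d := op_cat A) (- h) _]/(@dg_comp k A _ _ _ z2 (- h)).
  by rewrite ocNl ocNr; zmod.
move=> [z2 [z1 [z0 [h [h1 [e [-> -> -> [kP cz2 [hh1 dh1] [he de]]]]]]]]].
have kP' : is_cokernel (z0 : A(A0, A1)) (z1 : A(A1, A2)) (- h).
  by apply/op_kernelP; rewrite opprK.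
have [cz0 cz1 _ _ _] := kP'; move/(@op_closed0 _ A(A2, S A0)): cz2 => cz2.
have [y2 y2E e2] := hcls_closed cz2; have [y1 y1E e1] := hcls_closed cz1.
have [y0 y0E e0] := hcls_closed cz0.
exists y0, y1, y2, (- h), (- h1), e; rewrite y2E y1E y0E; split=> //.
- by apply/(right_exactP A_nonpositive); rewrite y1E y0E.
- move/(op_difP A(A1, S A0) _ hh1): dh1 => dh1; split; first exact: homogN.
  by rewrite difN dh1 scaleN1r opprK.
move/(op_difP A(A0, S A0) _ he): de => de; split=> //.
rewrite de sgnN2 scale1r ocNl ocNr /op_s.
rewrite -[dg_comp (d := op_cat A) _ h1]/(@dg_comp k A _ _ _ h1 z0).
rewrite -[dg_comp (d := op_cat A) h _]/(@dg_comp k A _ _ _ z2 h).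
zmod.
Qed.

End Standard.
End HomotopyClasses.

Lemma left_triangulated_ext (C : preaddCat) (Om : C -> C)
    (Om1 : forall X Y : C, mor X Y -> mor (Om X) (Om Y)) (D D' : left_class Om) :
  (forall A C0 B h g f, D A C0 B h g f <-> D' A C0 B h g f) ->
  left_triangulated Om1 D -> left_triangulated Om1 D'.
Proof.
move=> DD'; suff -> : D = D' by [].
do 6 ![apply: functional_extensionality_dep => ?]; exact/propext.
Qed.

Lemma isomorphism_idm (C : preaddCat) (X : C) : isomorphism (idm X).
Proof. by exists (idm X); rewrite mcomp1l. Qed.

(** Needed because an isomorphism out of a standard right triangle becomes, in the opposite
    category, one into it and must be inverted. *)
Lemma square_inverse (C : preaddCat) (X Y X' Y' : C) (g : mor X Y) (f : mor X' Y')
    (x : mor X X') x' (y : mor Y Y') y' :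
  y' \oh y = idm Y -> x \oh x' = idm X' -> y \oh g = f \oh x ->
  g \oh x' = y' \oh f.
Proof.
move=> y'y xx' E.
by rewrite -[LHS]mcomp1l -y'y -mcompA (mcompA y) E -(mcompA f) xx' mcomp1r.
Qed.

(** * The pretriangulated structure *)

Section Structure.
Context {k : comPzRingType} (A : dgCat k).
Hypothesis A_nonpositive : nonpositive A.
Hypothesis A_preabelian : preabelian A.
Variables (L : forall X : A, loop X) (S : forall X : A, suspension X).
Implicit Types X Y Z W : A.

Let l X : A(L X, X) := loop_map (L X).
Let s X : A(X, S X) := susp_map (S X).
Let op_s X : @dg_hom k (op_cat A) (S X) X := - s X.
Let lP X : is_loop (l X) := is_loop_of A_nonpositive (L X).
Let sP X : is_suspension (s X) := is_suspension_of A_nonpositive (S X).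
Let op_sP X : @is_loop k (op_cat A) X (S X) (op_s X) := (op_loopP (s X)).2 (sP X).

Section LeftRight.
Variable Om1 : forall X Y : H0 A, mor X Y -> mor (loop_obj L X) (loop_obj L Y).
Hypothesis Om1P :
  @is_loop_functor_of k A (H0_presentation A) (fun X => L X) l Om1.

Lemma loop_functorP : is_loop_functor Om1.
Proof.
move=> X Y f f'; rewrite -!hclsE.
exact: (Om1P (closed_cocycle f) (closed_cocycle f')).
Qed.

Lemma left_closureE A0 A2 A1 f2 f1 f0 :
  left_iso_closure Om1 (standard_left L) A0 A2 A1 f2 f1 f0 <->
  standard_left L A0 A2 A1 f2 f1 f0.
Proof.
split=> [|T].
  move=> [B0 [B2 [B1 [g2 [g1 [g0 [c [b [a [T ic ib ia m]]]]]]]]]].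
  move/(standard_leftE A_nonpositive): T => T.
  apply/(standard_leftE A_nonpositive).
  apply: (triangles_iso (P := H0_presentation A) lP Om1P).
  by exists B0, B2, B1, g2, g1, g0, c, b, a.
exists A0, A2, A1, f2, f1, f0, (idm _), (idm _), (idm _).
have iso := @isomorphism_idm (H0 A).
split=> //; have F := loop_additive_functor lP Om1P.
by split; rewrite ?(functor_id F) mcomp1l mcomp1r.
Qed.

Lemma standard_left_triangulated :
  left_triangulated Om1 (left_iso_closure Om1 (standard_left L)).
Proof.
have [addA _ _] := A_preabelian.
apply: left_triangulated_ext (triangles_left_triangulated lP Om1P addA
  (preabelian_kernel A_nonpositive A_preabelian)) => A0 A2 A1 f2 f1 f0.
by rewrite left_closureE standard_leftE.
Qed.

End LeftRight.

Definition is_suspension_functor_of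
    (Sg1 : forall X Y : H0 A, mor X Y -> mor (susp_obj S X) (susp_obj S Y)) :
    Prop :=
  forall X Y (f : A(X, Y)) (f' : A(S X, S Y)), is_closed 0 f -> is_closed 0 f' ->
    Sg1 X Y (hcls f) = hcls f' <->
    exists2 t, homog (-2) t & dif t = f' \oc s X - s Y \oc f.

Section RightLeft.
Variable Sg1 : forall X Y : H0 A, mor X Y -> mor (susp_obj S X) (susp_obj S Y).
Hypothesis Sg1P : @is_loop_functor_of k (op_cat A) (op_presentation A)
  (fun X => S X) op_s (fun X Y => Sg1 (X := Y) (Y := X)).

Lemma suspension_functorP : is_suspension_functor_of Sg1.
Proof.
move=> X Y f f' /(@op_closed0 _ A(X, Y)) cf /(@op_closed0 _ A(S X, S Y)) cf'.
apply: (iff_trans (Sg1P cf cf')).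
have E : dg_comp (d := op_cat A) (op_s X) f'
      - dg_comp (d := op_cat A) f (op_s Y) =
    - (f' \oc s X - s Y \oc f) :> A(X, S Y).
  rewrite -[dg_comp (d := op_cat A) (op_s X) _]/(f' \oc (- s X)).
  rewrite -[dg_comp (d := op_cat A) _ (op_s Y)]/((- s Y) \oc f).
  by rewrite ocNl ocNr; zmod.
split=> -[t ht].
  move/(op_difP A(X, S Y) _ ht); rewrite E sgnN2 scale1r => dt.
  by exists (- t); [exact: homogN | rewrite difN dt opprK].
move=> dt; exists (- t); first exact: homogN.
by apply/(op_difP A(X, S Y) _ (homogN ht)); rewrite E sgnN2 scale1r difN dt.
Qed.

Lemma right_closureE A0 A1 A2 f0 f1 f2 :
  right_iso_closure Sg1 (standard_right S) A0 A1 A2 f0 f1 f2 <->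
  standard_right S A0 A1 A2 f0 f1 f2.
Proof.
have F :=
  @loop_additive_functor k (op_cat A) (op_presentation A) _ op_s op_sP _ Sg1P.
split=> [|T].
  move=> [B0 [B1 [B2 [g0 [g1 [g2 [a [b [c []]]]]]]]]].
  move=> /(standard_rightE A_nonpositive) T [a' a'a aa'] [b' b'b bb'].
  move=> [c' c'c cc'] [E0 E1 E2]; apply/(standard_rightE A_nonpositive).
  apply: (@triangles_iso k (op_cat A) (op_presentation A) _ op_s op_sP _ Sg1P).
  exists B0, B2, B1, g2, g1, g0, c', b', a'; split=> //.
  - by exists c.
  - by exists b.
  - by exists a.
  have Saa : Sg1 a' \oh Sg1 a = idm (susp_obj S B0).
    apply: (etrans (esym (functor_comp F a a'))).
    by apply: (etrans (congr1 _ a'a)); exact: (functor_id F B0).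
  by split; [exact: square_inverse Saa cc' E2 | exact: square_inverse c'c bb' E1
    | exact: square_inverse b'b aa' E0].
exists A0, A1, A2, f0, f1, f2, (idm _), (idm _), (idm _).
have iso := @isomorphism_idm (H0 A).
split=> //; split; rewrite ?mcomp1l ?mcomp1r //.
by have -> : Sg1 (idm A0) = idm _ := functor_id F A0; rewrite mcomp1l.
Qed.

Lemma standard_right_triangulated :
  right_triangulated Sg1 (right_iso_closure Sg1 (standard_right S)).
Proof.
have [addA _ _] := A_preabelian.
apply: left_triangulated_ext (@triangles_left_triangulated k (op_cat A)
  (op_presentation A) _ op_s op_sP _ Sg1P (op_additive addA)
  (preabelian_cokernel A_nonpositive A_preabelian)) => A0 A2 A1 f2 f1 f0.
by rewrite /op_class right_closureE standard_rightE.
Qed.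

End RightLeft.

Definition adjoint X Y (f : A(S X, Y)) (f' : A(X, L Y)) : Prop :=
  exists2 t, homog (-2) t & dif t = f \oc s X + l Y \oc f'.

Definition is_adjunction_of
    (adj : forall X Y : H0 A, mor (susp_obj S X) Y -> mor X (loop_obj L Y)) :
    Prop :=
  forall X Y (f : A(S X, Y)) (f' : A(X, L Y)), is_closed 0 f -> is_closed 0 f' ->
    adj X Y (hcls f) = hcls f' <-> adjoint f f'.

Lemma adjoint_exists X Y (f : A(S X, Y)) : is_closed 0 f ->
  exists2 f', is_closed 0 f' & adjoint f f'.
Proof.
move=> cf; have [[hs ds _] [hl dl _]] := (sP X, lP Y).
have [|||f' [t [hf' df' ht dt]]] :=
  loop_lift (i := 0) (v := - (f \oc s X)) (lP Y); try dg.
by exists f'; [split | exists t; dg].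
Qed.

Lemma adjoint_exists_inverse X Y (f' : A(X, L Y)) : is_closed 0 f' ->
  exists2 f, is_closed 0 f & adjoint f f'.
Proof.
move=> cf'; have [[hs ds _] [hl dl _]] := (sP X, lP Y).
have [||f [t [cf ht dt]]] := suspension_lift (v := - (l Y \oc f')) (sP X); try dg.
by exists f; [|exists t; dg].
Qed.

(** Up to homotopy each adjoint determines the other, by [loop_inj] and [suspension_inj]; this makes
    the correspondence well defined and bijective. *)
Lemma adjoint_eq X Y (f g : A(S X, Y)) (f' g' : A(X, L Y)) :
  is_closed 0 f -> is_closed 0 g -> is_closed 0 f' -> is_closed 0 g' ->
  adjoint f f' -> adjoint g g' -> hcls f = hcls g <-> hcls f' = hcls g'.
Proof.
move=> cf cg cf' cg' [t ht dt] [r hr dr].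
have [[hs ds _] [hl dl _]] := (sP X, lP Y).
split=> [/(hcls_eq cf cg)|/(hcls_eq cf' cg')] [w hw dw]; apply/hcls_eq=> //.
  by apply: (loop_inj (lP Y) (t := t - r - w \oc s X)); dg.
by apply: (suspension_inj (t := t - r + l Y \oc w) (sP X)); dg.
Qed.

Lemma adjunction_exists : exists adj, is_adjunction_of adj.
Proof.
have exR X Y (f : @mor (H0 A) (susp_obj S X) Y) :
    exists f' : @mor (H0 A) X (loop_obj L Y), exists u v,
    [/\ is_closed 0 u, is_closed 0 v, f = hcls u, f' = hcls v & adjoint u v].
  have [u cu ->] := hcls_surj f; have [v cv uv] := adjoint_exists cu.
  by exists (hcls v), u, v.
exists (fun X Y f => sval (cid (exR X Y f))) => X Y f f' cf cf'.
case: cid => /= _ [u [v [cu cv fu -> uv]]].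
have [g cg gf'] := adjoint_exists_inverse cf'.
split=> [/(adjoint_eq cu cg cv cf' uv gf')|ff'].
  rewrite -fu => /(hcls_eq cf cg)[w hw dw]; case: gf' => t ht dt.
  have [[hs ds _] [hl dl _]] := (sP X, lP Y).
  by exists (t + w \oc s X); dg.
exact/(adjoint_eq cu cf cv cf' uv ff').
Qed.

Section Adjunction.
Variable Om1 : forall X Y : H0 A, mor X Y -> mor (loop_obj L X) (loop_obj L Y).
Hypothesis Om1P :
  @is_loop_functor_of k A (H0_presentation A) (fun X => L X) l Om1.
Variable Sg1 : forall X Y : H0 A, mor X Y -> mor (susp_obj S X) (susp_obj S Y).
Hypothesis Sg1P : is_suspension_functor_of Sg1.
Variable adj : forall X Y : H0 A, mor (susp_obj S X) Y -> mor X (loop_obj L Y).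
Hypothesis adjP : is_adjunction_of adj.

Lemma suspension_loop_adjunctionP : is_suspension_loop_adjunction adj.
Proof.
move=> X Y f f'; rewrite -!hclsE.
exact: (adjP (closed_cocycle f) (closed_cocycle f')).
Qed.

Lemma adj_adjunction : adjunction Sg1 Om1 adj.
Proof.
split=> [X Y|X' X Y Y' a f b].
  have ex (f' : @mor (H0 A) X (loop_obj L Y)) : exists f, adj f = f'.
    have [v cv ->] := hcls_surj f'; have [u cu uv] := adjoint_exists_inverse cv.
    by exists (hcls u); apply/adjP.
  exists (fun f' => sval (cid (ex f'))) => [f|f']; last by case: cid.
  case: cid => /= g; have [u cu ->] := hcls_surj f; have [v cv ->] := hcls_surj g.
  have [u' cu' uu'] := adjoint_exists cu; have [v' cv' vv'] := adjoint_exists cv.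
  rewrite ((adjP cu cu').2 uu') ((adjP cv cv').2 vv').
  by move/(adjoint_eq cv cu cv' cu' vv' uu').
have [a0 ca ->] := hcls_surj a; have [b0 cb ->] := hcls_surj b.
have [f0 cf ->] := hcls_surj f.
have [[hs ds _] [hs' ds' _]] := (sP X, sP X').
have [[hl dl _] [hl' dl' _]] := (lP Y, lP Y').
have [f' cf' [t ht dt]] := adjoint_exists cf.
have -> : adj (hcls f0) = hcls f' by apply/adjP => //; exists t.
have [b' [cb' [r hr dr]]] := loop_map_exists lP cb.
have -> : Om1 (hcls b0) = hcls b' by apply/Om1P => //; exists r.
have [||a' [q [ca' hq dq]]] := suspension_lift (v := s X \oc a0) (sP X'); try dg.
have -> : Sg1 (hcls a0) = hcls a' by apply/Sg1P => //; exists q.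
rewrite -!hcls_comp //; try dg.
apply/adjP; try dg.
(* The differentials of the three terms telescope: the homotopies for the suspension of [a0], for
   the adjoint of [f0] and for the loop of [b0] are applied in turn. *)
by exists (b0 \oc f0 \oc q + b0 \oc t \oc a0 + r \oc f' \oc a0); dg.
Qed.

End Adjunction.

(** * Ladders between right and left triangles *)

Definition is_cotriangle X Y Z (f : A(X, Y)) (g : A(Y, Z)) (h : A(Z, S X))
    (H : A(X, Z)) (H1 : A(Y, S X)) (e : A(X, S X)) : Prop :=
  [/\ is_cokernel f g H, is_closed 0 h, homog (-1) H1 /\ dif H1 = - (h \oc g)
    & homog (-2) e /\ dif e = s X + h \oc H - H1 \oc f].

Section Ladders.
Variables (X Y Z : A) (f : A(X, Y)) (g : A(Y, Z)) (h : A(Z, S X)) (H : A(X, Z))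
  (H1 : A(Y, S X)) (e : A(X, S X)) (X' Y' Z' : A) (f' : A(L Z', X'))
  (g' : A(X', Y')) (h' : A(Y', Z')) (K : A(X', Z')) (K1 : A(L Z', Y'))
  (e' : A(L Z', Z')).
Hypothesis fghP : is_cotriangle f g h H H1 e.
Hypothesis fghP' : is_triangle (l Z') f' g' h' K K1 e'.

(** The cokernel property produces [c] with the middle square. The right square follows from
    injectivity, where [t] links the term [a' \oc s X] coming from [e] to the term [l Z' \oc a]
    coming from [e']. *)
Lemma ladder_right (a : A(X, L Z')) (b : A(Y, X')) (a' : A(S X, Z')) :
  is_closed 0 a -> is_closed 0 b -> is_closed 0 a' -> adjoint a' a ->
  hcls (b \oc f) = hcls (f' \oc a) ->
  exists c, [/\ is_closed 0 c, hcls (c \oc g) = hcls (g' \oc b)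
    & hcls (a' \oc h) = hcls (h' \oc c)].
Proof.
move=> ca cb ca' [t ht dt].
have [fgH ch [hH1 dH1] [he de]] := fghP; have [cf cg hH dH _] := fgH.
have [[cg' ch' hK dK _] cf' [hK1 dK1] [he' de']] := fghP'.
have [[hs ds _] [hl dl _]] := (sP X, lP Z').
move=> /hcls_eq[||q hq dq]; try dg.
(* [K1] contracts [g' \oc f'] and [q] is the left square, so together they contract
   [g' \oc b \oc f]. *)
have [|||c [r [v [cc hr hv dr dv]]]] :=
  cokernel_lift (m := g' \oc b) (n := K1 \oc a - g' \oc q) fgH; try dg.
exists c; split=> //; apply/hcls_eq; try dg; first by exists r; dg.
have [|||||w hw dw] := cokernel_inj (u := h' \oc c - a' \oc h)
  (s := h' \oc r - K \oc b + a' \oc H1)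
  (t := h' \oc v + e' \oc a + K \oc q + t - a' \oc e) fgH; try dg.
by exists (- w); dg.
Qed.

(** Dually, the kernel property produces [b] with the middle square, and injectivity for the kernel
    gives the left square. *)
Lemma ladder_left (c : A(Z, Y')) (v : A(S X, Z')) (v' : A(X, L Z')) :
  is_closed 0 c -> is_closed 0 v -> is_closed 0 v' -> adjoint v v' ->
  hcls (v \oc h) = hcls (h' \oc c) ->
  exists b, [/\ is_closed 0 b, hcls (b \oc f) = hcls (f' \oc v')
    & hcls (c \oc g) = hcls (g' \oc b)].
Proof.
move=> cc cv cv' [t ht dt].
have [[cf cg hH dH _] ch [hH1 dH1] [he de]] := fghP.
have [kP cf' [hK1 dK1] [he' de']] := fghP'; have [cg' ch' hK dK _] := kP.
have [[hs ds _] [hl dl _]] := (sP X, lP Z').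
move=> /hcls_eq[||q hq dq]; try dg.
have [|||b [r [w [cb hr hw dr dw]]]] :=
  kernel_lift (m := c \oc g) (n := q \oc g + v \oc H1) kP; try dg.
exists b; split=> //; apply/hcls_eq; try dg; last by exists (- r); dg.
have [|||||y hy dy] := kernel_inj (u := b \oc f - f' \oc v')
  (s := r \oc f - c \oc H + K1 \oc v')
  (t := v \oc e + w \oc f - q \oc H - e' \oc v' - t) kP; try dg.
by exists y.
Qed.

End Ladders.

Lemma standard_right_cotriangle A0 A1 A2 f0 f1 f2 :
  standard_right S A0 A1 A2 f0 f1 f2 -> exists z0 z1 z2 h h1 e,
    [/\ f0 = hcls z0, f1 = hcls z1, f2 = hcls z2 & is_cotriangle z0 z1 z2 h h1 e].
Proof.
move=> [z0 [z1 [z2 [h [h1 [e [[-> -> ->]]]]]]]].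
move=> /(right_exactP A_nonpositive) kP hh1 he.
exists z0, z1, z2, h, h1, e; rewrite !hclsE; split=> //; split=> //.
exact: closed_cocycle.
Qed.

Lemma homotopy_category_pretriangulated
    (Om1 : forall X Y : H0 A, mor X Y -> mor (loop_obj L X) (loop_obj L Y))
    (Sg1 : forall X Y : H0 A, mor X Y -> mor (susp_obj S X) (susp_obj S Y))
    (adj : forall X Y : H0 A, mor (susp_obj S X) Y -> mor X (loop_obj L Y)) :
  @is_loop_functor_of k A (H0_presentation A) (fun X => L X) l Om1 ->
  @is_loop_functor_of k (op_cat A) (op_presentation A) (fun X => S X) op_s
    (fun X Y => Sg1 Y X) ->
  is_adjunction_of adj ->
  pretriangulated Sg1 Om1 adj (left_iso_closure Om1 (standard_left L))
    (right_iso_closure Sg1 (standard_right S)).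
Proof.
move=> Om1P Sg1P adjP; split.
- exact: (adj_adjunction Om1P (suspension_functorP Sg1P) adjP).
- exact: standard_left_triangulated.
- exact: standard_right_triangulated.
- move=> X Y Z f g h Z' X' Y' f' g' h' a b a'.
  move=> /(right_closureE Sg1P)/standard_right_cotriangle.
  move=> [z0 [z1 [z2 [k0 [k1 [e [-> -> -> R]]]]]]].
  move=> /(left_closureE Om1P)/(standard_leftE A_nonpositive).
  move=> [y2 [y1 [y0 [j0 [j1 [d [-> -> -> T]]]]]]].
  have [a0 ca ->] := hcls_surj a; have [b0 cb ->] := hcls_surj b.
  have [c0 cc ->] := hcls_surj a' => /(adjP _ _ _ _ cc ca) aP.
  case: (R) (T) => [[cz0 cz1 _ _ _] cz2 _ _] [[cy1 cy0 _ _ _] cy2 _ _].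
  rewrite -[pcl _ y2]/(hcls y2) -!hcls_comp // => E.
  have [c [cc' E1 E2]] := ladder_right R T ca cb cc aP E.
exists (hcls c); split; first by rewrite -hcls_comp.
  by rewrite E2 hcls_comp.
move=> X Y Z f g h Z' X' Y' f' g' h' c v v'.
move=> /(right_closureE Sg1P)/standard_right_cotriangle.
move=> [z0 [z1 [z2 [k0 [k1 [e [-> -> -> R]]]]]]].
move=> /(left_closureE Om1P)/(standard_leftE A_nonpositive).
move=> [y2 [y1 [y0 [j0 [j1 [d [-> -> -> T]]]]]]].
have [c0 cc ->] := hcls_surj c; have [v0 cv ->] := hcls_surj v.
have [v1 cv1 ->] := hcls_surj v' => /(adjP _ _ _ _ cv cv1) vP.
case: (R) (T) => [[cz0 cz1 _ _ _] cz2 _ _] [[cy1 cy0 _ _ _] cy2 _ _].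
rewrite -[pcl _ y0]/(hcls y0) -!hcls_comp // => E.
have [b [cb E1 E2]] := ladder_left R T cc cv cv1 vP E.
exists (hcls b); split; first by rewrite -hcls_comp.
by rewrite E2 hcls_comp.
Qed.

End Structure.

Theorem theorem1 (k : comPzRingType) (A : dgCat k)
    (A_nonpositive : nonpositive A) (A_preabelian : preabelian A) :
  (forall X : A, inhabited (loop X)) /\
  (forall X : A, inhabited (suspension X)) /\
  forall (L : forall X : A, loop X) (S : forall X : A, suspension X),
    exists (Om1 : forall X Y : H0 A,
              mor X Y -> mor (loop_obj L X) (loop_obj L Y))
           (Sg1 : forall X Y : H0 A,
              mor X Y -> mor (susp_obj S X) (susp_obj S Y))
           (adj : forall X Y : H0 A,
              mor (susp_obj S X) Y -> mor X (loop_obj L Y)),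
      is_loop_functor Om1 /\
      is_suspension_functor Sg1 /\
      is_suspension_loop_adjunction adj /\
      pretriangulated Sg1 Om1 adj
        (left_iso_closure Om1 (standard_left L))
        (right_iso_closure Sg1 (standard_right S)).
Proof.
split; first exact: preabelian_loop.
split; first exact: preabelian_suspension.
move=> L S.
have [Om1 Om1P] := @loop_functor_exists k A (H0_presentation A) (fun X => L X) _
  (fun X => is_loop_of A_nonpositive (L X)).
have [Om1' Sg1P] := @loop_functor_exists k (op_cat A) (op_presentation A)
  (fun X => S X) _
  (fun X => (op_loopP (susp_map (S X))).2 (is_suspension_of A_nonpositive (S X))).
have [adj adjP] := adjunction_exists A_nonpositive L S.
(* The suspension functor is the loop functor of the opposite category with source and target
   exchanged. *)
pose Sg1 (X Y : H0 A) : mor X Y -> mor (susp_obj S X) (susp_obj S Y) := Om1' Y X.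
exists Om1, Sg1, adj; split; first exact: loop_functorP.
split.
  move=> X Y f f'; rewrite -!hclsE.
  exact: (suspension_functorP (Sg1 := Sg1) Sg1P
    (closed_cocycle f) (closed_cocycle f')).
split; first exact: suspension_loop_adjunctionP.
exact: homotopy_category_pretriangulated.
Qed.
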